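(* Let $\{f_i\}_{i=1}^\infty$ be a sequence of uniformly bounded measurable functions $f_i\in L^\infty(A_i)$ on compact abelian groups $A_i$, converging to $f\in L^2(A)$ (on a compact abelian group $A$) in the metric $d'$. Then $\mu_{f_i}$ converges to $\mu_f$ in the weak topology of measures.
   Context: All compact abelian groups are second countable with normalized Haar measure. For measurable $f$ on $A$, $\mu_f$ is the distribution on $\mathbb{C}$ of $f(x)$ with $x$ Haar-random in $A$. Metric $\hat d$: for a group $G$, $l^2(G)$ is the set of $f:G\to\mathbb{C}$ with $\sum_g|f(g)|^2<\infty$; ${\rm supp}_\epsilon(f)=\{g:|f(g)|>\epsilon\}$. A partial isomorphism of weight $n$ between groups $G_1,G_2$ is a bijection $\phi:S_1\to S_2$ ($S_j\subseteq G_j$) such that for all $g_1,\dots,g_n\in S_1$, $\alpha_i\in\{-1,0,1\}$: $g_1^{\alpha_1}\cdots g_n^{\alpha_n}=1$ iff $\phi(g_1)^{\alpha_1}\cdots\phi(g_n)^{\alpha_n}=1$. An $\epsilon$-isomorphism between $f_1\in l^2(G_1)$, $f_2\in l^2(G_2)$ is a partial isomorphism $\phi:S_1\to S_2$ of weight $\lceil1/\epsilon\rceil$ with ${\rm supp}_\epsilon(f_j)\subseteq S_j$ and $|f_1(g)-f_2(\phi(g))|\le\epsilon$ for $g\in S_1$; $\hat d(f_1,f_2)$ is the infimum of such $\epsilon$. For $f_j\in L^2(A_j)$, $d(f_1,f_2)=\hat d(\hat f_1,\hat f_2)$ with $\hat f_j$ the Fourier transform on the dual group, and $d'(f_1,f_2)=d(f_1,f_2)+\big|\|f_1\|_2-\|f_2\|_2\big|$.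 Convergence in $d'$ (''tight convergence'') means convergence in $d$ together with convergence of $L^2$ norms to that of the limit. *)

(* Defs.v *)
From HB Require Import structures.
From mathcomp Require Import all_boot all_order all_algebra.
From mathcomp Require Import all_classical all_reals all_analysis.
From mathcomp.real_closed Require Import complex.

Set Implicit Arguments.
Unset Strict Implicit.
Unset Printing Implicit Defensive.

Import Order.TTheory GRing.Theory Num.Theory.
Import numFieldNormedType.Exports.
Import ComplexField.Normc.

Local Open Scope classical_set_scope.
Local Open Scope ring_scope.

(* The library only puts the norm topology on the alias R[i]^o. *)
HB.instance Definition _ (R : realType) := PseudoPointedMetric.copy R[i] R[i]^o.
HB.instance Definition _ (R : realType) := NormedModule.copy R[i] R[i]^o.

(* Generated sigma-algebras are only available over pointed types. *)
HB.instance Definition _ (A : topologicalZmodType) := isPointed.Build A 0.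

Definition borel (T : ptopologicalType) : Type := g_sigma_algebraType (@open T).
HB.instance Definition _ (T : ptopologicalType) := Measurable.on (borel T).

Definition compact_abelian_group (A : topologicalZmodType) : Prop :=
  [/\ hausdorff_space A, compact [set: A] & @second_countable A].

(* Normalization is the fact that mu is a probability; invariance then
   determines mu, regularity being automatic in the second countable case. *)
Definition haar (R : realType) (A : topologicalZmodType)
    (mu : probability (borel A) R) : Prop :=
  forall (x : A) (E : set A), measurable (E : set (borel A)) ->
    mu [set x + y | y in E] = mu E.

(* The Pontryagin dual, written multiplicatively under pointwise product;
   `|chi x| = 1 makes (chi x)^-1 the complex conjugate of chi x. *)
Section dual.
Variables (R : realType) (A : topologicalZmodType).

Definition is_character (chi : A -> R[i]) : Prop :=
  [/\ continuous chi, forall x y, chi (x + y) = chi x * chi y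
    & forall x, `|chi x| = 1].

Record dual_group : Type := Dual {
  character :> A -> R[i];
  characterP : is_character character }.

HB.instance Definition _ := gen_eqMixin dual_group.
HB.instance Definition _ := gen_choiceMixin dual_group.

Lemma dual_eq (chi psi : dual_group) : chi =1 psi -> chi = psi.
Proof.
case: chi psi => [c hc] [p hp] /= /funext e.
by rewrite e in hc *; congr Dual; exact: Prop_irrelevance.
Qed.

Lemma is_character1 : is_character (fun=> 1).
Proof.
split=> [x||]; [exact: cvg_cst|by move=> x y; rewrite mulr1|].
by move=> x; rewrite normr1.
Qed.

Lemma is_characterM (chi psi : dual_group) :
  is_character (fun x => chi x * psi x).
Proof.
case: chi psi => [c [c1 c2 c3]] [p [p1 p2 p3]] /=; split=> [x|x y|x].
- by apply: cvgM; [exact: c1|exact: p1].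
- by rewrite c2 p2 mulrACA.
- by rewrite normrM c3 p3 mulr1.
Qed.

Lemma is_characterV (chi : dual_group) : is_character (fun x => (chi x)^-1).
Proof.
case: chi => [c [c1 c2 c3]] /=; split=> [x|x y|x].
- apply: cvgV; last exact: c1.
  by rewrite -normr_eq0 c3 oner_eq0.
- by rewrite c2 invfM.
- by rewrite normfV c3 invr1.
Qed.

Definition dual_one := Dual is_character1.
Definition dual_mul chi psi := Dual (is_characterM chi psi).
Definition dual_inv chi := Dual (is_characterV chi).

Lemma dual_mulA : associative dual_mul.
Proof. by move=> c p q; apply: dual_eq => x /=; rewrite mulrA. Qed.

Lemma dual_mul1 : left_id dual_one dual_mul.
Proof. by move=> c; apply: dual_eq => x /=; rewrite mul1r. Qed.

Lemma dual_mulr1 : right_id dual_one dual_mul.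
Proof. by move=> c; apply: dual_eq => x /=; rewrite mulr1. Qed.

Lemma dual_mulV : left_inverse dual_one dual_inv dual_mul.
Proof.
move=> c; apply: dual_eq => x /=; rewrite mulVf// -normr_eq0.
by case: (characterP c) => _ _ ->; rewrite oner_eq0.
Qed.

Lemma dual_mulrV : right_inverse dual_one dual_inv dual_mul.
Proof.
move=> c; apply: dual_eq => x /=; rewrite mulfV// -normr_eq0.
by case: (characterP c) => _ _ ->; rewrite oner_eq0.
Qed.

HB.instance Definition _ := isGroup.Build dual_group
  dual_mulA dual_mul1 dual_mulr1 dual_mulV dual_mulrV.

End dual.

Section d_hat.
Local Open Scope group_scope.

Definition gexpz (G : groupType) (x : G) (a : int) : G :=
  match a with Posz n => x ^+ n | Negz n => x ^- n.+1 end.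

(* phi is a total function, but only its values on S1 matter. *)
Definition partial_isomorphism (G1 G2 : groupType) (n : nat)
    (S1 : set G1) (S2 : set G2) (phi : G1 -> G2) : Prop :=
  set_bij S1 S2 phi /\
  forall (g : 'I_n -> G1) (alpha : 'I_n -> int),
    (forall i, S1 (g i)) ->
    (forall i, alpha i \in [:: (-1)%R; 0%R; 1%R]) ->
    \prod_(i < n) gexpz (g i) (alpha i) = 1 <->
    \prod_(i < n) gexpz (phi (g i)) (alpha i) = 1.

Local Open Scope ring_scope.

Definition supp (R : realType) (G : groupType) (eps : R) (f : G -> R[i]) :
  set G := [set g | eps < normc (f g)].

Definition eps_isomorphism (R : realType) (G1 G2 : groupType) (eps : R)
    (f1 : G1 -> R[i]) (f2 : G2 -> R[i])
    (S1 : set G1) (S2 : set G2) (phi : G1 -> G2) : Prop :=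
  [/\ partial_isomorphism `|Num.ceil eps^-1|%N S1 S2 phi,
      supp eps f1 `<=` S1, supp eps f2 `<=` S2
    & forall g, S1 g -> normc (f1 g - f2 (phi g)) <= eps].

(* The infimum is taken in \bar R; it is finite as soon as f1 and f2 are
   bounded, in particular on l^2, because the empty partial isomorphism is
   an eps-isomorphism for large eps. *)
Definition d_hat (R : realType) (G1 G2 : groupType)
    (f1 : G1 -> R[i]) (f2 : G2 -> R[i]) : \bar R :=
  ereal_inf [set eps%:E | eps in [set eps : R | 0 < eps /\
    exists S1 S2 phi, eps_isomorphism eps f1 f2 S1 S2 phi]].

End d_hat.

Section fourier.
Variable R : realType.

Definition cintegral (d : measure_display) (T : measurableType d)
    (mu : {measure set T -> \bar R}) (f : T -> R[i]) : R[i] :=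
  ((\int[mu]_x complex.Re (f x)) +i* (\int[mu]_x complex.Im (f x)))%C.

Definition fourier (A : topologicalZmodType) (mu : probability (borel A) R)
    (f : A -> R[i]) (chi : dual_group R A) : R[i] :=
  cintegral mu (fun x => f x * (chi x)^*%C).

Definition L2norm (d : measure_display) (T : measurableType d)
    (mu : {measure set T -> \bar R}) (f : T -> R[i]) : \bar R :=
  'N[mu]_2%:E[EFin \o (@normc R \o f)]%E.

(* The Fourier transforms are in l^2 of the dual groups by Bessel's
   inequality when f1 and f2 are in L^2. *)
Definition d_L2 (A1 A2 : topologicalZmodType)
    (mu1 : probability (borel A1) R) (mu2 : probability (borel A2) R)
    (f1 : A1 -> R[i]) (f2 : A2 -> R[i]) : \bar R :=
  d_hat (fourier mu1 f1) (fourier mu2 f2).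

(* The metric d' = d + | ||f1||_2 - ||f2||_2 | of tight convergence. *)
Definition d_tight (A1 A2 : topologicalZmodType)
    (mu1 : probability (borel A1) R) (mu2 : probability (borel A2) R)
    (f1 : A1 -> R[i]) (f2 : A2 -> R[i]) : \bar R :=
  (d_L2 mu1 mu2 f1 f2 + `|L2norm mu1 f1 - L2norm mu2 f2|)%E.

Definition weak_cvg (T : ptopologicalType)
    (P : nat -> probability (borel T) R) (Q : probability (borel T) R) : Prop :=
  forall g : T -> R, continuous g -> (exists M : R, forall x, `|g x| <= M) ->
    \int[P n]_x g x @[n --> \oo] --> \int[Q]_x g x.

End fourier.

(* Main.v *)
(* By Parseval, [f] is within a small [L2] distance of a trigonometric polynomial
   [p = \sum_(chi in F) b chi * chi], [b] being the Fourier transform of [f].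
   When [d'(f_i, f)] is small, the partial isomorphism is defined on [F] and
   carries [p] to a trigonometric polynomial [p_i] on [A_i]; the closeness of the
   Fourier coefficients together with that of the [L2] norms makes [f_i] close to
   [p_i] in [L2].  A word in the characters and their conjugates integrates to 1
   or 0 according to whether the corresponding product of characters is trivial,
   so once the weight exceeds the degree of a polynomial [Q] in [z] and its
   conjugate, [Q o p_i] and [Q o p] have the same integral.  As [p] and all the
   [p_i] take values in a common disc, a Weierstrass approximation [Q] of the
   test function there concludes.

   Completeness of the characters, needed for Parseval, comes from an extremal
   problem.  For continuous [k <> 0], let [J h] be the correlation of [k] with [h]
   and [U h] the autocorrelation of [J h].  Along a sequence maximizing the [L2]
   norm of [U h] over the unit ball, [U h] clusters uniformly at some [u <> 0].
   Comparing [h] with the combinations of [h] and its translates, equality in the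
   triangle inequality forces [u (a + x) * u 0 = u a * u x], so that [u / u 0] is a
   character, and it is not orthogonal to [k]. *)
Require Import Defs.
From mathcomp Require Import all_boot all_order all_algebra.
From mathcomp Require Import all_classical all_reals all_analysis.
From mathcomp.real_closed Require Import complex.
From mathcomp Require Import measurable_realfun ring lra.
Import Order.TTheory GRing.Theory Num.Theory.
Import numFieldNormedType.Exports.
Import ComplexField.Normc.

Set Implicit Arguments.
Unset Strict Implicit.
Unset Printing Implicit Defensive.
Local Open Scope classical_set_scope.
Local Open Scope ring_scope.

(** * Complex integration and square integrable functions *)

Section complex_numbers.
Context {R : realType}.
Implicit Types z w : R[i].

(** The unit ball of L2 is not norm compact, so the extremal problem need not have a maximizer. What
    saves it is smoothing by [k]: the bound and the modulus of continuity of [U h] depend on [h]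
    only through its norm, so the [U h] of a maximizing sequence have a uniform cluster point [u],
    which need not be of the form [U h]. As [U] is quadratic, the parallelogram identity bounds the
    two comparison functions together, and the equality case is drawn only in the limit, for [u]
    itself. The same compactness yields Parseval: the remainders of the projections of [h] need not
    cluster visibly, but their autocorrelations do, and these record the squared norm of the
    remainder at 0 and the squared moduli of its coefficients. Since [f] is only known to be square
    integrable, a disc carries [p] but not [f]. The test function is therefore controlled by a
    modulus [e + K |z - w|^2 + c |z|^2], which integrates to squared distances and squared norms.
    Zero coefficients are dropped from [F], so that the remaining ones are bounded below and [F]
    lies in the domain of every fine enough partial isomorphism. *)

Lemma sqr_normcE z : normc z ^+ 2 = complex.Re z ^+ 2 + complex.Im z ^+ 2.
Proof. by case: z => a b /=; rewrite sqr_sqrtr// addr_ge0// sqr_ge0. Qed.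

Lemma normc_ge0 z : 0 <= normc z.
Proof. by case: z => a b; apply: sqrtr_ge0. Qed.

Lemma normr_normc z : `|z| = (normc z)%:C%C.
Proof. by case: z. Qed.

Lemma mulcJ z : z * z^*%C = (normc z ^+ 2)%:C%C.
Proof. by rewrite sqr_normcE; case: z => a b; congr Complex => /=; ring. Qed.

Lemma conjcD z w : (z + w)^*%C = z^*%C + w^*%C.
Proof. exact: (rmorphD (@conjc R)). Qed.

Lemma conjcN z : (- z)^*%C = - z^*%C.
Proof. exact: (rmorphN (@conjc R)). Qed.

Lemma conjcM z w : (z * w)^*%C = z^*%C * w^*%C.
Proof. exact: (rmorphM (@conjc R)). Qed.

Lemma conjc_sum (I : Type) (s : seq I) (F : I -> R[i]) :
  (\sum_(i <- s) F i)^*%C = \sum_(i <- s) (F i)^*%C.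
Proof. exact: (rmorph_sum (@conjc R)). Qed.

Lemma normcJ z : normc z^*%C = normc z.
Proof. by case: z => a b /=; rewrite sqrrN. Qed.

Lemma normc_real (x : R) : normc x%:C%C = `|x|.
Proof. by rewrite /= expr0n /= addr0 sqrtr_sqr. Qed.

Lemma normc_nat (n : nat) : normc (n%:R : R[i]) = n%:R.
Proof. by rewrite -(rmorph_nat (real_complex R)) [LHS]normc_real ger0_norm. Qed.

Lemma ler_Re_normc z : `|complex.Re z| <= normc z.
Proof.
rewrite -(@ler_pXn2r _ 2) ?nnegrE ?normc_ge0// real_normK ?num_real//.
by rewrite sqr_normcE lerDl sqr_ge0.
Qed.

Lemma ler_Im_normc z : `|complex.Im z| <= normc z.
Proof.
rewrite -(@ler_pXn2r _ 2) ?nnegrE ?normc_ge0// real_normK ?num_real//.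
by rewrite sqr_normcE lerDr sqr_ge0.
Qed.

Lemma ler_normc_ReIm z : normc z <= `|complex.Re z| + `|complex.Im z|.
Proof.
rewrite -(@ler_pXn2r _ 2) ?nnegrE ?normc_ge0// ?addr_ge0//.
by rewrite sqr_normcE sqrrD !real_normK ?num_real// -addrA lerD2l lerDr
  mulrn_wge0// mulr_ge0.
Qed.

Lemma normc_triangle z w : normc (z + w) <= normc z + normc w.
Proof. exact: le_normcD. Qed.

Lemma normcB_triangle z w : normc (z - w) <= normc z + normc w.
Proof. by rewrite (le_trans (normc_triangle _ _))// normcN. Qed.

Lemma sqr_normcB_le4 z w : normc z <= 1 -> normc w <= 1 -> normc (z - w) ^+ 2 <= 4.
Proof.
have := normcB_triangle z w; have := normc_ge0 (z - w).
move: (normc (z - w)) (normc z) (normc w) => r1 r2 r3; nra.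
Qed.

Lemma distcC z w : normc (z - w) = normc (w - z).
Proof. by rewrite -normcN opprB. Qed.

Lemma ler_dist_normc z w : `|normc z - normc w| <= normc (z - w).
Proof.
have := normc_triangle (z - w) w; have := normc_triangle (w - z) z.
by rewrite !subrK (distcC w) => h1 h2; rewrite ler_norml; apply/andP; split; lra.
Qed.

Lemma ReZ (a : R) z : complex.Re (a%:C%C * z) = a * complex.Re z.
Proof. by case: z => x y /=; ring. Qed.

Lemma ReD z w : complex.Re (z + w) = complex.Re z + complex.Re w.
Proof. by case: z; case: w. Qed.

Lemma ImD z w : complex.Im (z + w) = complex.Im z + complex.Im w.
Proof. by case: z; case: w. Qed.

Lemma ReN z : complex.Re (- z) = - complex.Re z.
Proof. by case: z. Qed.

Lemma ImN z : complex.Im (- z) = - complex.Im z.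
Proof. by case: z. Qed.

Lemma Re_sum (I : Type) (s : seq I) (F : I -> R[i]) :
  complex.Re (\sum_(i <- s) F i) = \sum_(i <- s) complex.Re (F i).
Proof. by elim: s => [|i s ih]; rewrite ?big_nil// !big_cons ReD ih. Qed.

Lemma sqr_normcB z w : normc (z - w) ^+ 2 =
  normc z ^+ 2 + normc w ^+ 2 - 2 * complex.Re (z^*%C * w).
Proof. by rewrite !sqr_normcE; case: z => a b; case: w => c d /=; ring. Qed.

Lemma nbhs_normcP z (U : set R[i]) :
  nbhs z U <-> exists2 e : R, 0 < e & forall w, normc (z - w) < e -> U w.
Proof.
rewrite -nbhs_ballE; split.
(* A positive element of [R[i]] has zero imaginary part, so the radius of a ball is in fact a
   positive real. *)
- move=> [e /= e0 h]; case: e e0 h => a b; rewrite ltcE /= => /andP[/eqP b0 a0].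
  rewrite b0 => h; exists a => // w zw; apply: h.
  by rewrite /ball /= normr_normc ltcR.
- move=> [e e0 h]; exists e%:C%C; first by rewrite /= ltcR.
  by move=> w; rewrite /ball /= normr_normc ltcR => /h.
Qed.

Lemma continuous_normcP (T : topologicalType) (f : T -> R[i]) :
  continuous f <->
  forall x (e : R), 0 < e -> \forall y \near x, normc (f x - f y) < e.
Proof.
split=> cf x.
  move=> e e0; have := cf x [set w | normc (f x - w) < e]; apply.
  by apply/nbhs_normcP; exists e.
move=> U /nbhs_normcP[e e0 eU].
by near=> y; apply: eU; near: y; exact: cf.
Unshelve. all: by end_near. Qed.

Lemma continuous_ReIm (T : topologicalType) (f : T -> R[i]) :
  continuous f <-> continuous (fun x => complex.Re (f x)) /\
                   continuous (fun x => complex.Im (f x)).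
Proof.
split=> [/continuous_normcP cf|[cr ci]].
  split=> x; apply/cvgrPdist_lt => e e0; have := cf x e e0; apply: filterS => y;
    apply: le_lt_trans.
  - by rewrite -ReN -ReD ler_Re_normc.
  - by rewrite -ImN -ImD ler_Im_normc.
apply/continuous_normcP => x e e0.
have e2 : 0 < e / 2 by rewrite divr_gt0.
near=> y; rewrite (le_lt_trans (ler_normc_ReIm _))// ReD ImD ReN ImN.
rewrite (splitr e) ltrD//; near: y.
  by move/cvgrPdist_lt : (cr x) => /(_ _ e2).
by move/cvgrPdist_lt : (ci x) => /(_ _ e2).
Unshelve. all: by end_near. Qed.

Lemma continuous_conjc (T : topologicalType) (f : T -> R[i]) :
  continuous f -> continuous (fun x => (f x)^*%C).
Proof.
move=> /continuous_normcP cf; apply/continuous_normcP => x e e0.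
have := cf x e e0; apply: filterS => y.
by rewrite -normcJ rmorphB /=.
Qed.

Lemma continuous_normc (T : topologicalType) (f : T -> R[i]) :
  continuous f -> continuous (fun x => normc (f x)).
Proof.
move=> /continuous_normcP cf x; apply/cvgrPdist_lt => e e0.
have := cf x e e0; apply: filterS => y; apply: le_lt_trans.
exact: ler_dist_normc.
Qed.

End complex_numbers.

(** * Integration of complex-valued functions *)

Section complex_integral.
Context {R : realType} {d : measure_display} {T : measurableType d}.
Variable mu : probability T R.
Implicit Types f g h : T -> R[i].

(** Componentwise, to match [cintegral]; [borel_cmeasurable] derives it from Borel measurability
    into [R[i]]. *)
Definition cmeasurable f :=
  measurable_fun setT (fun x => complex.Re (f x)) /\
  measurable_fun setT (fun x => complex.Im (f x)).

Definition cintegrable f :=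
  mu.-integrable setT (fun x => (complex.Re (f x))%:E) /\
  mu.-integrable setT (fun x => (complex.Im (f x))%:E).

Lemma cmeasurable_cst (c : R[i]) : cmeasurable (fun=> c).
Proof. by split; exact: measurable_cst. Qed.

Lemma cmeasurableD f g :
  cmeasurable f -> cmeasurable g -> cmeasurable (fun x => f x + g x).
Proof.
move=> [fr fi] [gr gi]; split.
  under eq_fun do rewrite ReD; exact: measurable_funD.
under eq_fun do rewrite ImD; exact: measurable_funD.
Qed.

Lemma cmeasurableM f g :
  cmeasurable f -> cmeasurable g -> cmeasurable (fun x => f x * g x).
Proof.
move=> [fr fi] [gr gi]; split.
  rewrite (_ : (fun _ => _) = (fun x => complex.Re (f x) * complex.Re (g x)
     - complex.Im (f x) * complex.Im (g x))); last first.
    by apply/funext => x; case: (f x); case: (g x).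
  by apply: measurable_funB; exact: measurable_funM.
rewrite (_ : (fun _ => _) = (fun x => complex.Re (f x) * complex.Im (g x)
   + complex.Im (f x) * complex.Re (g x))); last first.
  by apply/funext => x; case: (f x); case: (g x).
by apply: measurable_funD; exact: measurable_funM.
Qed.

Lemma cmeasurable_conj f :
  cmeasurable f -> cmeasurable (fun x => (f x)^*%C).
Proof.
move=> [fr fi]; split.
  rewrite (_ : (fun _ => _) = (fun x => complex.Re (f x)))//.
  by apply/funext => x; case: (f x).
rewrite (_ : (fun _ => _) = (\- (fun x => complex.Im (f x)))).
  exact: measurableT_comp.
by apply/funext => x /=; case: (f x).
Qed.

Lemma cmeasurable_normc_sqr f :
  cmeasurable f -> measurable_fun setT (fun x => normc (f x) ^+ 2).
Proof.
move=> [fr fi]; under eq_fun do rewrite sqr_normcE.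
by apply: measurable_funD; exact: measurable_funX.
Qed.

Lemma bounded_integrable (f : T -> R) (M : R) :
  measurable_fun setT f -> (forall x, `|f x| <= M) ->
  mu.-integrable setT (EFin \o f).
Proof.
move=> mf fM; apply: (@le_integrable _ _ _ _ _ _ _ (EFin \o cst M)) => //.
- exact/measurable_EFinP.
- move=> x _ /=; rewrite lee_fin (le_trans (fM x))// ler_norm//.
- exact: finite_measure_integrable_cst.
Qed.

Lemma cintegrable_bounded f (M : R) :
  cmeasurable f -> (forall x, normc (f x) <= M) -> cintegrable f.
Proof.
move=> [fr fi] fM; split; apply: (@bounded_integrable _ M) => // x.
- by rewrite (le_trans (ler_Re_normc _)).
- by rewrite (le_trans (ler_Im_normc _)).
Qed.

Lemma cintegrableD f g :
  cintegrable f -> cintegrable g -> cintegrable (fun x => f x + g x).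
Proof.
move=> [fr fi] [gr gi]; split.
  under eq_fun do rewrite ReD EFinD; exact: integrableD.
under eq_fun do rewrite ImD EFinD; exact: integrableD.
Qed.

Lemma cintegrableZ (c : R[i]) f :
  cintegrable f -> cintegrable (fun x => c * f x).
Proof.
case: c => a b [fr fi]; split.
  rewrite (_ : (fun _ => _) = (fun x => a%:E * (complex.Re (f x))%:E
     - b%:E * (complex.Im (f x))%:E)%E); last first.
    by apply/funext => x; rewrite -!EFinM -EFinB; case: (f x).
  by apply: integrableB => //; exact: integrableZl.
rewrite (_ : (fun _ => _) = (fun x => a%:E * (complex.Im (f x))%:E
   + b%:E * (complex.Re (f x))%:E)%E); last first.
  by apply/funext => x; rewrite -!EFinM -EFinD; case: (f x).
by apply: integrableD => //; exact: integrableZl.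
Qed.

Lemma cintegrable_sum (I : Type) (s : seq I) (F : I -> T -> R[i]) :
  (forall i, cintegrable (F i)) -> cintegrable (fun x => \sum_(i <- s) F i x).
Proof.
move=> hF; elim: s => [|i s ih].
  under eq_fun do rewrite big_nil.
  apply: (@cintegrable_bounded _ 0); first exact: cmeasurable_cst.
  by move=> x; rewrite normc0.
by under eq_fun do rewrite big_cons; exact: cintegrableD.
Qed.

Lemma cintegralD f g : cintegrable f -> cintegrable g ->
  cintegral mu (fun x => f x + g x) = cintegral mu f + cintegral mu g.
Proof.
move=> [fr fi] [gr gi]; rewrite /cintegral; congr Complex.
  by under eq_Rintegral do rewrite ReD; rewrite RintegralD.
by under eq_Rintegral do rewrite ImD; rewrite RintegralD.
Qed.

Lemma cintegralZ (c : R[i]) f : cintegrable f ->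
  cintegral mu (fun x => c * f x) = c * cintegral mu f.
Proof.
case: c => a b [fr fi]; rewrite /cintegral; congr Complex.
  rewrite (_ : (fun _ => _) = (fun x => a * complex.Re (f x)
     - b * complex.Im (f x))); last by apply/funext => x; case: (f x).
  rewrite RintegralB ?RintegralZl//.
    exact: (integrableZl _ a fr).
  exact: (integrableZl _ b fi).
rewrite (_ : (fun _ => _) = (fun x => a * complex.Im (f x)
   + b * complex.Re (f x))); last by apply/funext => x; case: (f x).
rewrite RintegralD ?RintegralZl//.
  exact: (integrableZl _ a fi).
exact: (integrableZl _ b fr).
Qed.

Lemma cintegral_conj f : cintegrable f ->
  cintegral mu (fun x => (f x)^*%C) = (cintegral mu f)^*%C.
Proof.
move=> [fr fi]; rewrite /cintegral /=; congr Complex.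
  by apply: eq_Rintegral => x _; case: (f x).
rewrite -mulN1r -RintegralZl//.
by apply: eq_Rintegral => x _; rewrite mulN1r; case: (f x).
Qed.

Lemma cintegral0 : cintegral mu (fun=> 0) = 0.
Proof. by rewrite /cintegral /= !Rintegral_cst// !mul0r. Qed.

Lemma cintegral_cst (c : R[i]) : cintegral mu (fun=> c) = c.
Proof.
by rewrite /cintegral !Rintegral_cst//= probability_setT !mulr1; case: c.
Qed.

Lemma cintegral_sum (I : Type) (s : seq I) (F : I -> T -> R[i]) :
  (forall i, cintegrable (F i)) ->
  cintegral mu (fun x => \sum_(i <- s) F i x) = \sum_(i <- s) cintegral mu (F i).
Proof.
move=> hF; elim: s => [|i s ih].
  by under eq_fun do rewrite big_nil; rewrite cintegral0 big_nil.
under eq_fun do rewrite big_cons; rewrite cintegralD ?ih ?big_cons//.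
exact: cintegrable_sum.
Qed.

Lemma eq_cintegral f g : f =1 g -> cintegral mu f = cintegral mu g.
Proof. by move=> /funext ->. Qed.

End complex_integral.

(** * Inner product and norm of L2 *)

Section square_integrable.
Context {R : realType} {d : measure_display} {T : measurableType d}.
Variable mu : probability T R.
Implicit Types f g h : T -> R[i].

Definition L2 f := cmeasurable f /\
  mu.-integrable setT (fun x => (normc (f x) ^+ 2)%:E).

(** Antilinear in the second argument; for a character [chi], [ip mu f chi] is by conversion the
    Fourier coefficient [fourier mu f chi]. *)
Definition ip f g := cintegral mu (fun x => f x * (g x)^*%C).

(** The squared L2 norm as a real number. It is meaningful under [L2] only, since an infinite
    integral is sent to 0. *)
Definition nn f := \int[mu]_x (normc (f x) ^+ 2).

Lemma L2_bounded f (M : R) :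
  cmeasurable f -> (forall x, normc (f x) <= M) -> L2 f.
Proof.
move=> mf fM; split => //; apply: (@bounded_integrable _ _ _ _ _ (M ^+ 2)).
  exact: cmeasurable_normc_sqr.
move=> x; rewrite ger0_norm ?sqr_ge0// lerXn2r ?nnegrE ?normc_ge0//.
by rewrite (le_trans _ (fM x))// normc_ge0.
Qed.

Lemma L2D f g : L2 f -> L2 g -> L2 (fun x => f x + g x).
Proof.
move=> [mf If] [mg Ig]; have mfg := cmeasurableD mf mg; split => //.
apply: (@le_integrable _ _ _ _ _ _ _
    (fun x => (2 * (normc (f x) ^+ 2 + normc (g x) ^+ 2))%:E)) => //.
- by apply/measurable_EFinP; exact: cmeasurable_normc_sqr.
- move=> x _; rewrite /= lee_fin !ger0_norm ?sqr_ge0//; last first.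
    by rewrite mulr_ge0// addr_ge0// sqr_ge0.
  apply: (@le_trans _ _ ((normc (f x) + normc (g x)) ^+ 2)).
    by rewrite lerXn2r ?nnegrE ?addr_ge0 ?normc_ge0// normc_triangle.
  by have := sqr_ge0 (normc (f x) - normc (g x)); lra.
- under eq_fun do rewrite EFinM EFinD; apply: integrableZl => //.
  exact: (integrableD measurableT If Ig).
Qed.

Lemma L2Z (c : R[i]) f : L2 f -> L2 (fun x => c * f x).
Proof.
move=> [mf If]; split; first by apply: cmeasurableM => //; exact: cmeasurable_cst.
by under eq_fun do rewrite normcM exprMn EFinM; exact: integrableZl.
Qed.

Lemma L2N f : L2 f -> L2 (fun x => - f x).
Proof. by move=> /(L2Z (-1)); under eq_fun do rewrite mulN1r. Qed.

Lemma L2B f g : L2 f -> L2 g -> L2 (fun x => f x - g x).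
Proof. by move=> hf hg; apply: L2D => //; exact: L2N. Qed.

Lemma L2_cst (c : R[i]) : L2 (fun=> c).
Proof. exact: (@L2_bounded _ (normc c) (cmeasurable_cst _)). Qed.

Lemma L2_sum (I : Type) (s : seq I) (F : I -> T -> R[i]) :
  (forall i, L2 (F i)) -> L2 (fun x => \sum_(i <- s) F i x).
Proof.
move=> hF; elim: s => [|i s ih].
  by under eq_fun do rewrite big_nil; exact: L2_cst.
by under eq_fun do rewrite big_cons; exact: L2D.
Qed.

Lemma L2_mulJ f g : L2 f -> L2 g -> cintegrable mu (fun x => f x * (g x)^*%C).
Proof.
move=> [mf If] [mg Ig].
have [mr mi] := cmeasurableM mf (cmeasurable_conj mg).
have Ib : mu.-integrable setT
    (fun x => (normc (f x) ^+ 2 + normc (g x) ^+ 2)%:E).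
  by under eq_fun do rewrite EFinD; exact: integrableD.
have b x : normc (f x * (g x)^*%C) <= normc (f x) ^+ 2 + normc (g x) ^+ 2.
  rewrite normcM normcJ; have := sqr_ge0 (normc (f x) - normc (g x)).
  have := sqr_ge0 (normc (f x)); have := sqr_ge0 (normc (g x)); lra.
split; apply: (le_integrable _ _ _ Ib) => //; try exact/measurable_EFinP.
- move=> x _; rewrite /= lee_fin (le_trans (ler_Re_normc _))//.
  by rewrite (le_trans (b x))// ler_norm.
- move=> x _; rewrite /= lee_fin (le_trans (ler_Im_normc _))//.
  by rewrite (le_trans (b x))// ler_norm.
Qed.

Lemma ipDl f g h : L2 f -> L2 g -> L2 h ->
  ip (fun x => f x + g x) h = ip f h + ip g h.
Proof.
move=> hf hg hh; rewrite /ip -cintegralD; try exact: L2_mulJ.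
by under eq_fun do rewrite mulrDl.
Qed.

Lemma ipZl (c : R[i]) f g : L2 f -> L2 g ->
  ip (fun x => c * f x) g = c * ip f g.
Proof.
move=> hf hg; rewrite /ip -cintegralZ; last exact: L2_mulJ.
by under eq_fun do rewrite -mulrA.
Qed.

Lemma ipC f g : L2 f -> L2 g -> ip g f = (ip f g)^*%C.
Proof.
move=> hf hg; rewrite /ip -cintegral_conj; last exact: L2_mulJ.
by under [in RHS]eq_fun do rewrite conjcM conjcK mulrC.
Qed.

Lemma ipDr f g h : L2 f -> L2 g -> L2 h ->
  ip h (fun x => f x + g x) = ip h f + ip h g.
Proof.
move=> hf hg hh; rewrite ipC ?ipDl//; last exact: L2D.
by rewrite conjcD -!ipC.
Qed.

Lemma ipZr (c : R[i]) f g : L2 f -> L2 g ->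
  ip g (fun x => c * f x) = c^*%C * ip g f.
Proof.
move=> hf hg; rewrite ipC ?ipZl//; last exact: L2Z.
by rewrite conjcM -ipC.
Qed.

Lemma ipNl f g : L2 f -> L2 g -> ip (fun x => - f x) g = - ip f g.
Proof.
move=> hf hg; rewrite -mulN1r -ipZl//.
by under [in RHS]eq_fun do rewrite mulN1r.
Qed.

Lemma ipNr f g : L2 f -> L2 g -> ip g (fun x => - f x) = - ip g f.
Proof. by move=> hf hg; rewrite ipC ?ipNl// ?conjcN -?ipC//; exact: L2N. Qed.

Lemma ipBl f g h : L2 f -> L2 g -> L2 h ->
  ip (fun x => f x - g x) h = ip f h - ip g h.
Proof. by move=> hf hg hh; rewrite ipDl ?ipNl//; exact: L2N. Qed.

Lemma ip_suml (I : Type) (s : seq I) (F : I -> T -> R[i]) g :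
  (forall i, L2 (F i)) -> L2 g ->
  ip (fun x => \sum_(i <- s) F i x) g = \sum_(i <- s) ip (F i) g.
Proof.
move=> hF hg; rewrite /ip -cintegral_sum => [|i]; last exact: L2_mulJ.
by under eq_fun do rewrite mulr_suml.
Qed.

Lemma ip_sumr (I : Type) (s : seq I) (F : I -> T -> R[i]) g :
  (forall i, L2 (F i)) -> L2 g ->
  ip g (fun x => \sum_(i <- s) F i x) = \sum_(i <- s) ip g (F i).
Proof.
move=> hF hg; rewrite ipC ?ip_suml//; last exact: L2_sum.
by rewrite conjc_sum; apply: eq_bigr => i _; rewrite -ipC.
Qed.

Lemma ipE f : ip f f = (nn f)%:C%C.
Proof.
rewrite /ip /cintegral /nn; congr Complex.
  by under eq_Rintegral do rewrite mulcJ.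
by under eq_Rintegral do rewrite mulcJ /=; rewrite Rintegral_cst// mul0r.
Qed.

Lemma nn0 : nn (fun=> 0) = 0.
Proof. by apply: complexI; rewrite -ipE /ip; under eq_fun do rewrite mul0r; exact: cintegral0. Qed.

Lemma nn_ge0 f : 0 <= nn f.
Proof. by apply: Rintegral_ge0 => x _; exact: sqr_ge0. Qed.

Lemma nnD f g : L2 f -> L2 g ->
  nn (fun x => f x + g x) = nn f + nn g + 2 * complex.Re (ip f g).
Proof.
move=> hf hg; apply: complexI; rewrite -[LHS]ipE.
have hfg := L2D hf hg.
rewrite ipDl// !ipDr// (ipC hf hg) !ipE /real_complex_def.
by case: (ip f g) => a b; congr Complex => /=; ring.
Qed.

Lemma nnZ (c : R[i]) f : L2 f -> nn (fun x => c * f x) = normc c ^+ 2 * nn f.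
Proof.
move=> hf; apply: complexI; rewrite -[LHS]ipE.
rewrite ipZl// ?ipZr//; last exact: L2Z.
by rewrite mulrA mulcJ ipE -(rmorphM (real_complex R)).
Qed.

Lemma nnN f : nn (fun x => - f x) = nn f.
Proof. by rewrite /nn; under eq_Rintegral do rewrite normcN. Qed.

Lemma nnB f g : L2 f -> L2 g ->
  nn (fun x => f x - g x) = nn f + nn g - 2 * complex.Re (ip f g).
Proof.
move=> hf hg; rewrite nnD ?nnN ?ipNr//; last exact: L2N.
by rewrite ReN mulrN.
Qed.

Lemma parallelogram f g : L2 f -> L2 g ->
  nn (fun x => f x + g x) + nn (fun x => f x - g x) = 2 * nn f + 2 * nn g.
Proof. by move=> hf hg; rewrite nnD ?nnB//; ring. Qed.

(** Expands the squared norm of [f - s <f, g> g] for real [s]. The minimizing [s] is the inverse of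
    [nn g]; if [nn g = 0], the expression is affine in [s] and a large [s] would make it equal to
    -1. *)
Lemma cauchy_schwarz f g : L2 f -> L2 g ->
  normc (ip f g) ^+ 2 <= nn f * nn g.
Proof.
move=> hf hg; set N := normc (ip f g) ^+ 2.
have key (s : R) : 0 <= nn f - 2 * s * N + s ^+ 2 * N * nn g.
  have := nn_ge0 (fun x => f x - (s%:C%C * ip f g) * g x).
  rewrite nnB// ?nnZ ?ipZr//; last exact: L2Z.
  rewrite normcM exprMn normc_real real_normK ?num_real// -/N.
  rewrite conjcM conjc_real -mulrA ReZ mulrC.
  have -> : complex.Re ((ip f g)^*%C * ip f g) = N.
    by rewrite mulrC mulcJ.
  lra.
have N0 : 0 <= N := sqr_ge0 _.
have [g0|g0] := eqVneq (nn g) 0; last first.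
  have gp : 0 < nn g by rewrite lt_neqAle eq_sym g0 nn_ge0.
  have := key (nn g)^-1; rewrite -(ler_pM2r gp).
  rewrite mul0r mulrDl mulrBl.
  have -> : 2 * (nn g)^-1 * N * nn g = 2 * N by field.
  have -> : (nn g)^-1 ^+ 2 * N * nn g * nn g = N by field.
  lra.
rewrite g0 mulr0 leNgt; apply/negP => Np.
have := key ((nn f + 1) / (2 * N)); rewrite g0 mulr0 addr0.
have -> : 2 * ((nn f + 1) / (2 * N)) * N = nn f + 1.
  by field; rewrite gt_eqF.
lra.
Qed.

Definition nrm f := Num.sqrt (nn f).

Lemma nrm_ge0 f : 0 <= nrm f. Proof. exact: sqrtr_ge0. Qed.

Lemma sqr_nrm f : nrm f ^+ 2 = nn f. Proof. by rewrite sqr_sqrtr// nn_ge0. Qed.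

Lemma nrm_le f (M : R) : 0 <= M -> nn f <= M ^+ 2 -> nrm f <= M.
Proof.
by move=> M0 fM; rewrite -(@ler_pXn2r _ 2) ?nnegrE ?nrm_ge0// sqr_nrm.
Qed.

Lemma nrmZ (c : R[i]) f : L2 f -> nrm (fun x => c * f x) = normc c * nrm f.
Proof.
move=> hf; rewrite /nrm nnZ// sqrtrM ?sqr_ge0// sqrtr_sqr ger0_norm//.
exact: normc_ge0.
Qed.

Lemma cauchy_schwarz_nrm f g : L2 f -> L2 g ->
  normc (ip f g) <= nrm f * nrm g.
Proof.
move=> hf hg.
rewrite -(@ler_pXn2r _ 2) ?nnegrE ?normc_ge0// ?mulr_ge0 ?nrm_ge0//.
by rewrite exprMn !sqr_nrm cauchy_schwarz.
Qed.

Lemma minkowski f g : L2 f -> L2 g ->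
  nrm (fun x => f x + g x) <= nrm f + nrm g.
Proof.
move=> hf hg.
rewrite -(@ler_pXn2r _ 2) ?nnegrE ?nrm_ge0// ?addr_ge0 ?nrm_ge0//.
rewrite sqr_nrm nnD// sqrrD !sqr_nrm.
have h1 := cauchy_schwarz_nrm hf hg.
have := le_trans (ler_norm _) (le_trans (ler_Re_normc _) h1); lra.
Qed.

Lemma le_nrm f (M : R) : 0 <= M -> (forall x, normc (f x) <= M) ->
  cmeasurable f -> nrm f <= M.
Proof.
move=> M0 fM mf; have [_ If] := L2_bounded mf fM.
rewrite -(@ler_pXn2r _ 2) ?nnegrE ?nrm_ge0// sqr_nrm.
apply: (@le_trans _ _ (\int[mu]_x (M ^+ 2))); last first.
  by rewrite Rintegral_cst//= probability_setT mulr1.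
apply: le_Rintegral => //.
  by apply: (@bounded_integrable _ _ _ _ _ (M ^+ 2)) => // x; rewrite ger0_norm ?sqr_ge0.
by move=> x _; rewrite lerXn2r ?nnegrE ?normc_ge0.
Qed.

End square_integrable.

(* Comparing atoms up to conversion, [lra] may unfold norms and integrals;
   hence they are generalized first. *)
Ltac norm_lra := repeat match goal with
  | |- context [@normc ?R ?z] => generalize (@normc R z)
  | |- context [@nrm ?R ?d ?T ?mu ?f] => generalize (@nrm R d T mu f)
  end;
  repeat match goal with H : is_true (_ _ _) |- _ => clear H end; intros; lra.

(** * Borel sets of spaces and of their products *)

Section borel_measurability.
Context {R : realType}.

Lemma countable_bigcup_measurable (d : measure_display) (T : measurableType d)
    (I : Type) (D : set I) (F : I -> set T) :
  countable D -> (forall i, D i -> measurable (F i)) ->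
  measurable (\bigcup_(i in D) F i).
Proof.
move=> /pfcard_geP[->|[s]] mF; first by rewrite bigcup_set0.
rewrite (_ : \bigcup_(i in D) F i = \bigcup_n F (s n)).
  by apply: bigcupT_measurable => n; apply: mF; exact: funS.
rewrite eqEsubset; split=> [x [i Di Fx]|x [n _ Fx]].
  by have [n _ sn] := @surj _ _ _ _ s i Di; exists n => //; rewrite sn.
by exists (s n) => //; exact: funS.
Qed.

Lemma open_borel (T : ptopologicalType) (U : set T) :
  open U -> measurable (U : set (borel T)).
Proof. by move=> oU; exact: sub_sigma_algebra. Qed.

Lemma continuous_borel_measurable (T : ptopologicalType) (f : T -> R) :
  continuous f -> measurable_fun [set: borel T] f.
Proof.
move=> /continuousP cf; apply: (measurability _ (RGenOpens.measurableE R)).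
move=> _ [_ [a [b ->] <-]]; rewrite setTI; apply: open_borel.
exact/cf/interval_open.
Qed.

Lemma continuous_cmeasurable (T : ptopologicalType) (f : T -> R[i]) :
  continuous f -> @cmeasurable _ _ (borel T) f.
Proof.
by move=> /continuous_ReIm[? ?]; split; exact: continuous_borel_measurable.
Qed.

Lemma borel_cmeasurable (d : measure_display) (T : measurableType d)
    (f : T -> borel R[i]) : measurable_fun setT f -> cmeasurable f.
Proof.
have cid : continuous (@id R[i]) by move=> x; exact: cvg_id.
move=> mf; have [mr mi] := continuous_cmeasurable cid; split.
  exact: (measurableT_comp mr mf).
exact: (measurableT_comp mi mf).
Qed.

(** Second countability makes an open set of the product a countable union of open rectangles. This
    puts continuous kernels on [A * A] within reach of Fubini. *)
Lemma open_prod_measurable (A B : ptopologicalType) (W : set (A * B)) :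
  @second_countable A -> @second_countable B -> open W ->
  measurable (W : set (borel A * borel B)).
Proof.
move=> [a ca [oa ba]] [b cb [ob bb]] oW.
pose D := [set p : set A * set B | [/\ a p.1, b p.2 & p.1 `*` p.2 `<=` W]].
rewrite (_ : W = \bigcup_(p in D) (p.1 `*` p.2)).
  apply: countable_bigcup_measurable.
    by apply: sub_countable (countableX ca cb); apply: subset_card_le => -[? ?] [].
  by move=> [U V] [/= aU bV _]; apply: measurableX; apply: open_borel; auto.
rewrite eqEsubset; split=> [[x y] Wxy|x [p [_ _ pW] px]]; last exact: pW.
have [[U V] /= [nU nV] UV] : nbhs (x, y) W by exact: open_nbhs_nbhs.
have [U' [aU' U'x] U'U] := ba x U nU; have [V' [bV' V'x] V'V] := bb y V nV.
exists (U', V') => //; split => // -[x' y'] [/= hx hy].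
by apply: UV; split; [exact: U'U|exact: V'V].
Qed.

End borel_measurability.

Lemma compact_continuous_bounded (R : realType) (T : topologicalType) (f : T -> R) :
  compact [set: T] -> continuous f -> exists2 M : R, 0 < M & forall x, f x <= M.
Proof.
move=> cT cf; have : compact [set f x | x in [set: T]].
  by apply: continuous_compact => //; exact: continuous_subspaceT.
move=> /compact_bounded[M [_ /(_ (`|M| + 1))]].
rewrite (le_lt_trans (ler_norm _)) ?ltrDl// => /(_ isT) h.
exists (`|M| + 1) => [|x]; first by rewrite ltr_wpDl.
by rewrite (le_trans (ler_norm _))//; apply: h; exists x.
Qed.

(** * Correlations on a compact abelian group *)

Section compact_group.
Context {R : realType} {A : topologicalZmodType}.
Variable mu : probability (borel A) R.
Hypotheses (hA : compact_abelian_group A) (hmu : haar mu).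
Implicit Types f g : A -> R[i].

Lemma continuous_bounded f : continuous f ->
  exists2 M : R, 0 < M & forall x, normc (f x) <= M.
Proof.
by move=> /continuous_normc cf; have [_ cA _] := hA; exact: compact_continuous_bounded.
Qed.

Lemma continuous_L2 f : continuous f -> L2 mu f.
Proof.
move=> cf; have [M _ fM] := continuous_bounded cf.
by apply: (@L2_bounded _ _ _ mu f M) => //; exact: continuous_cmeasurable.
Qed.

Lemma addl_continuous (a : A) : continuous (fun x : A => a + x).
Proof.
move=> x; apply: (@continuous_comp _ _ _ (fun x => (a, x))
  (fun p : A * A => p.1 + p.2)); last exact: add_continuous.
by apply: cvg_pair; [exact: cvg_cst|exact: cvg_id].
Qed.

Lemma open_addl (a : A) (U : set A) : open U -> open ((fun x => a + x) @^-1` U).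
Proof. by have /continuousP := @addl_continuous a; apply. Qed.

Lemma continuous_addl f (a : A) : continuous f -> continuous (fun x => f (a + x)).
Proof.
by move=> cf x; apply: continuous_comp; [exact: addl_continuous|exact: cf].
Qed.

(** Joint continuity of [f (u + x)] at [(x, 0)] gives the bound for all points near [x] and all
    small [u]; compactness of [A] then makes the choice of [u] independent of [x]. *)
Lemma uniform_continuity f (e : R) : continuous f -> 0 < e ->
  \forall u \near (0 : A), forall x, normc (f (u + x) - f x) < e.
Proof.
move=> cf e0; have [_ /compact_near_coveringP cA _] := hA.
have := cA A (nbhs 0) (fun u x => normc (f (u + x) - f x) < e) _.
have e2 : 0 < e / 2 by rewrite divr_gt0.
have h x : [set: A] x ->
    \forall x' \near x & u \near 0, normc (f (u + x') - f x') < e.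
  move=> _.
  have c1 : continuous (fun p : A * A => f (p.2 + p.1)).
    move=> p; apply: (@continuous_comp _ _ _ (fun p : A * A => p.2 + p.1)).
      apply: (@continuous_comp _ _ _ (fun p : A * A => (p.2, p.1))
        (fun p : A * A => p.1 + p.2)); last exact: add_continuous.
      by apply: cvg_pair; [exact: cvg_snd|exact: cvg_fst].
    exact: cf.
  have := proj1 (continuous_normcP _) c1 (x, 0) _ e2.
  have := proj1 (continuous_normcP _) cf x _ e2.
  rewrite /= add0r => n1 n2.
  have {}n1 : \forall p \near ((x, 0) : A * A), normc (f x - f p.1) < e / 2.
    by apply: cvg_fst n1.
  near=> p.
  rewrite (_ : _ - _ = (f x - f p.1) - (f x - f (p.2 + p.1))); last by ring.
  rewrite (le_lt_trans (normcB_triangle _ _))// (splitr e) ltrD//.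
    by near: p.
  by near: p.
move=> /(_ _ h) H; near=> u => x; have := near H u; apply => //.
Unshelve. all: by end_near. Qed.

Lemma haar_preimage (a : A) (E : set A) : measurable (E : set (borel A)) ->
  mu ((fun x => a + x) @^-1` E) = mu E.
Proof.
move=> mE; rewrite -(hmu (- a) mE); congr (mu _).
rewrite eqEsubset; split=> [x /= ax|_ [y Ey <-] /=]; last by rewrite addrA subrr add0r.
by exists (a + x) => //; rewrite addrA addNr add0r.
Qed.

Lemma measurable_addl (a : A) :
  measurable_fun [set: borel A] ((fun x => a + x) : borel A -> borel A).
Proof.
apply: (@measurability _ _ (borel A) (borel A) setT _ (@open A)) => //.
move=> _ [U oU <-]; rewrite setTI; apply: open_borel.
exact: open_addl.
Qed.

Lemma Rintegral_shift (h : A -> R) (a : A) :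
  measurable_fun [set: borel A] h ->
  mu.-integrable setT (fun x => (h (a + x))%:E) ->
  \int[mu]_x h (a + x) = \int[mu]_x h x.
Proof.
move=> mh ih; rewrite /Rintegral; congr fine.
rewrite -(@integral_pushforward _ _ (borel A) (borel A) R _ (measurable_addl a)
  mu setT (fun x => (h x)%:E))//; last exact/measurable_EFinP.
apply: eq_measure_integral => [|mf E mE _]; first exact: measurable_addl.
exact: haar_preimage.
Qed.

Lemma continuous_cintegrable f : continuous f -> cintegrable mu f.
Proof.
move=> cf; have [M _ fM] := continuous_bounded cf.
by apply: (@cintegrable_bounded _ _ _ mu f M) => //; exact: continuous_cmeasurable.
Qed.

Lemma cintegral_shift f (a : A) : continuous f ->
  cintegral mu (fun x => f (a + x)) = cintegral mu f.
Proof.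
move=> cf; have [ir ii] := continuous_cintegrable (continuous_addl (a := a) cf).
by have [mr mi] := continuous_cmeasurable cf; congr Complex; exact: Rintegral_shift.
Qed.

Lemma Rintegral_swap (F : A * A -> R) : continuous F ->
  \int[mu]_x \int[mu]_y F (x, y) = \int[mu]_y \int[mu]_x F (x, y).
Proof.
move=> cF; have [_ cA sA] := hA.
have cAA : compact [set: A * A] by rewrite -setXTT; exact: compact_setX.
have mF : measurable_fun [set: borel A * borel A] F.
  apply: (@measurability _ _ (borel A * borel A)%type _ setT F _
    (RGenOpens.measurableE R)).
  move=> _ [_ [a [b ->] <-]]; rewrite setTI; apply: open_prod_measurable => //.
  by move/continuousP : cF; apply; exact: interval_open.
have [M M0 FM] := compact_continuous_bounded cAA (fun x =>
  continuous_comp (cF x) (@norm_continuous _ R (F x))).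
have iF : (mu \x mu)%E.-integrable [set: borel A * borel A] (EFin \o F).
  exact: (@bounded_integrable _ _ _ (mu \x mu)%E F M).
have i1 x : mu.-integrable setT (EFin \o (fun y => F (x, y))).
  apply: (@bounded_integrable _ _ _ mu _ M); last by move=> y; exact: (FM (x, y)).
  apply: continuous_borel_measurable => y.
  apply: (@continuous_comp _ _ _ (fun y => (x, y))); last exact: cF.
  by apply: cvg_pair; [exact: cvg_cst|exact: cvg_id].
have i2 y : mu.-integrable setT (EFin \o (fun x => F (x, y))).
  apply: (@bounded_integrable _ _ _ mu _ M); last by move=> x; exact: (FM (x, y)).
  apply: continuous_borel_measurable => x.
  apply: (@continuous_comp _ _ _ (fun x => (x, y))); last exact: cF.
  by apply: cvg_pair; [exact: cvg_id|exact: cvg_cst].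
have := Fubini iF; rewrite /Rintegral /= => fub; congr fine.
transitivity (\int[mu]_x \int[mu]_y (F (x, y))%:E)%E.
  by apply: eq_integral => x _; rewrite fineK//; exact: (integrable_fin_num _ (i1 x)).
rewrite fub; apply: eq_integral => y _.
by rewrite fineK//; exact: (integrable_fin_num _ (i2 y)).
Qed.

Lemma cintegral_swap (F : A * A -> R[i]) : continuous F ->
  cintegral mu (fun x => cintegral mu (fun y => F (x, y))) =
  cintegral mu (fun y => cintegral mu (fun x => F (x, y))).
Proof.
move=> /continuous_ReIm[cr ci]; have hr := Rintegral_swap cr.
by have hi := Rintegral_swap ci; rewrite /cintegral /= hr hi.
Qed.

(** Haar measure charges every nonempty open set: finitely many translates of an open null set would
    cover [A], which has mass 1. Here the open set is where [f] does not vanish. *)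
Lemma nn_eq0 f : continuous f -> nn mu f = 0 -> forall x, f x = 0.
Proof.
move=> cf f0 x0; apply/eqP/negPn/negP => fx0.
have [_ cA _] := hA.
pose U := [set x | normc (f x) != 0].
have cn := continuous_normc cf.
have oU : open U.
  rewrite (_ : U = (fun x => normc (f x)) @^-1` (~` [set 0])).
    by move/continuousP : cn; apply; rewrite openC; exact: closed_eq.
  by apply/seteqP; split => x /= /eqP.
have Ux0 : U x0.
  by apply: contra fx0 => /eqP /eq0_normc ->.
have mn : measurable_fun [set: borel A] (fun x => (normc (f x) ^+ 2)%:E).
  by apply/measurable_EFinP; apply: cmeasurable_normc_sqr;
    exact: continuous_cmeasurable.
have U0 : mu U = 0%E.
  apply/negligibleP; first exact: open_borel.
  have : (\int[mu]_x `|(normc (f x) ^+ 2)%:E| = 0)%E.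
    under eq_integral do rewrite gee0_abs ?lee_fin ?sqr_ge0//.
    have [_ /(integrable_fin_num measurableT) If] := continuous_L2 cf.
    by rewrite -(fineK If) [fine _]f0.
  move/ae_eq_integral_abs => /(_ measurableT mn).
  apply: negligibleS => x /= Ux h; move: Ux; rewrite /U /= => /eqP; apply.
  by have := h I; rewrite /= => -[] /eqP; rewrite sqrf_eq0 => /eqP.
have := cA; rewrite compact_cover => /(_ A setT (fun a => (fun x => a + x) @^-1` U)).
case=> [a _|x _|D _ DA].
- exact: open_addl.
- by exists (x0 - x) => //=; rewrite subrK.
have : (mu [set: A] <= 0)%E.
  have mV a : measurable ((fun x => a + x) @^-1` U : set (borel A)).
    by apply: open_borel; exact: open_addl.
  have V0 (s : seq A) : 
      measurable (\big[setU/set0]_(a <- s) ((fun x => a + x) @^-1` U) : set (borel A)) /\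
      mu (\big[setU/set0]_(a <- s) ((fun x => a + x) @^-1` U)) = 0%E.
    elim: s => [|a s [ms s0]]; first by rewrite big_nil measure0.
    rewrite big_cons; split; first exact: measurableU.
    apply: (null_set_setU (mV a) ms _ s0); rewrite -U0.
    exact: (haar_preimage a (open_borel oU)).
  have [mD <-] := V0 (finmap.enum_fset D).
  apply: le_measure; rewrite ?inE//.
  by rewrite -bigcup_seq.
by rewrite probability_setT lee_fin ler10.
Qed.

Lemma continuous_unif f :
  (forall e : R, 0 < e -> \forall t \near (0 : A),
    forall x, normc (f (t + x) - f x) <= e) -> continuous f.
Proof.
move=> h; apply/continuous_normcP => x e e0.
have e2 : 0 < e / 2 by rewrite divr_gt0.
have := addl_continuous (a := - x) (x := x); rewrite /continuous_at addNr.
move=> /(_ _ (h _ e2)); rewrite /fmap/= /nbhs/=.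
apply: filterS => y /= /(_ x).
rewrite [- x + y]addrC subrK distcC => /le_lt_trans; apply.
by rewrite ltr_pdivrMr// ltr_pMr// ltr1n.
Qed.

Lemma compact_disc (C : R) : compact [set z : R[i] | normc z <= C].
Proof.
pose S := [set (p.1 +i* p.2)%C | p in (`[- C, C] `*` `[- C, C])%classic].
have cS : compact (S : set R[i]).
  apply: continuous_compact; last by apply: compact_setX; exact: segment_compact.
  apply: continuous_subspaceT; apply/continuous_ReIm; split => p /=.
    exact: cvg_fst.
  exact: cvg_snd.
apply: (subclosed_compact _ cS).
  have cn : continuous (fun z : R[i] => normc z).
    by apply: continuous_normc => z; exact: cvg_id.
  rewrite (_ : mkset _ = (fun z : R[i] => normc z) @^-1` [set x | x <= C]).
    by apply: closed_comp => // z _; exact: cn.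
  by [].
move=> z /= zC; exists (complex.Re z, complex.Im z); last by case: z {zC}.
split; rewrite /= in_itv /= -ler_norml.
  exact: le_trans (ler_Re_normc _) zC.
exact: le_trans (ler_Im_normc _) zC.
Qed.

(** Tychonoff provides a pointwise cluster point in a product of discs. Equicontinuity passes to it
    and turns closeness on a finite net into uniform closeness. The conclusion is kept in the form
    of arbitrarily large good indices, with no subsequence extracted. *)
Lemma ascoli_cluster (u : nat -> A -> R[i]) (C : R) :
  (forall n x, normc (u n x) <= C) ->
  (forall e : R, 0 < e -> \forall t \near (0 : A),
     forall n x, normc (u n (t + x) - u n x) <= e) ->
  exists2 w : A -> R[i], continuous w &
    forall (e : R) N, 0 < e -> exists2 n, (N <= n)%N &
      forall x, normc (u n x - w x) <= e.
Proof.
move=> uC equi.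
have := @tychonoff A (fun=> R[i]) (fun=> [set z | normc z <= C])
  (fun=> @compact_disc C).
move=> /(_ (u @ \oo) _); case.
  by exists 0%N => // n _ x; exact: uC.
move=> w [_ cw].
(* Closeness at finitely many points is a neighbourhood in the product topology, hence is met at
   indices beyond any [N]. *)
have net (s : seq A) (e : R) N : 0 < e -> exists2 n, (N <= n)%N &
    forall x, x \in s -> normc (u n x - w x) <= e.
  move=> e0.
  have [] := cw [set u n | n in [set n | (N <= n)%N]]
    [set g | forall x, x \in s -> normc (g x - w x) <= e].
  - by exists N => // n /= Nn; exists n.
  - elim: s => [|y s ih]; first exact: filterS filterT.
    have ny : nbhs w [set g : A -> R[i] | normc (g y - w y) <= e].
      have := @proj_continuous A (fun=> R[i]) y w [set z | normc (z - w y) <= e].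
      apply.
      by apply/nbhs_normcP; exists e => // z; rewrite distcC => /ltW.
    near=> g => x; rewrite inE => /orP[/eqP->|]; first by near: g.
    by move: x; near: g.
  - by move=> _ [[n Nn <-] h]; exists n.
have wequi (e : R) : 0 < e -> \forall t \near (0 : A),
    (forall n x, normc (u n (t + x) - u n x) <= e / 3) /\
    forall x, normc (w (t + x) - w x) <= e.
  move=> e0; have e3 : 0 < e / 3 by rewrite divr_gt0.
  have := equi _ e3; apply: filterS => t ht; split=> // x.
  have [n _ hn] := net [:: x; t + x] _ 0 e3.
  have h1 := hn x (mem_head _ _); have h2 := hn (t + x) _.
  rewrite !inE eqxx orbT in h2; have {}h2 := h2 isT.
  rewrite (_ : _ - _ = (u n (t + x) - u n x) + (u n x - w x)
    - (u n (t + x) - w (t + x))); last by ring.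
  have := normcB_triangle ((u n (t + x) - u n x) + (u n x - w x))
    (u n (t + x) - w (t + x)).
  have := normc_triangle (u n (t + x) - u n x) (u n x - w x).
  have := ht n x; lra.
exists w.
  apply: continuous_unif => e e0.
  by have := wequi _ e0; apply: filterS => t [].
move=> e N e0; have e3 : 0 < e / 3 by rewrite divr_gt0.
have [_ cA _] := hA.
have /nbhs_interior nU := wequi _ e3.
(* Translations in [U] move every [u n] by at most [e / 3] and [w] by at most [e / 3]; finitely many
   translates of its interior cover [A], and their centres form the net. *)
set U := (X in nbhs 0 X^°) in nU.
have := cA; rewrite compact_cover.
move=> /(_ A setT (fun a => (fun x => - a + x) @^-1` U^°)).
case=> [a _|x _|D _ DA].
- by apply: open_addl; exact: open_interior.
- by exists x => //=; rewrite addNr; exact: nbhs_singleton nU.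
have [n Nn hn] := net (finmap.enum_fset D) _ N e3.
exists n => // x; have [y yD /interior_subset[h1 h2]] := DA x I.
have := h1 n y; have := h2 y; have := hn y yD.
rewrite [- y + x]addrC subrK => k1 k2 k3.
rewrite (_ : _ - _ = (u n x - u n y) + (u n y - w y) - (w x - w y)); last by ring.
have := normcB_triangle ((u n x - u n y) + (u n y - w y)) (w x - w y).
have := normc_triangle (u n x - u n y) (u n y - w y); lra.
Unshelve. all: by end_near. Qed.

End compact_group.

(** * Translations and correlations *)

Section cross_correlation.
Context {R : realType} {A : topologicalZmodType}.
Variable mu : probability (borel A) R.
Hypotheses (hA : compact_abelian_group A) (hmu : haar mu).
Implicit Types f g h k v : A -> R[i].

Definition shift (a : A) f := fun x => f (a + x).

Definition cc f g (x : A) : R[i] := ip mu (shift x f) g.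

Local Notation ip := (ip mu).
Local Notation nn := (nn mu).
Local Notation nrm := (nrm mu).

Lemma continuous_shift a f : continuous f -> continuous (shift a f).
Proof. exact: continuous_addl. Qed.

Lemma continuous_cst (c : R[i]) : continuous (fun _ : A => c).
Proof. by move=> x; exact: cvg_cst. Qed.

Lemma continuousDf f g : continuous f -> continuous g ->
  continuous (fun x => f x + g x).
Proof. by move=> cf cg x; apply: cvgD; [exact: cf|exact: cg]. Qed.

Lemma continuousMf f g : continuous f -> continuous g ->
  continuous (fun x => f x * g x).
Proof. by move=> cf cg x; apply: cvgM; [exact: cf|exact: cg]. Qed.

Lemma continuousZf (c : R[i]) f : continuous f -> continuous (fun x => c * f x).
Proof. by move=> cf; exact: (continuousMf (@continuous_cst c) cf). Qed.

Lemma continuousBf f g : continuous f -> continuous g ->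
  continuous (fun x => f x - g x).
Proof. by move=> cf cg x; apply: cvgB; [exact: cf|exact: cg]. Qed.

Let cL2 f : continuous f -> L2 mu f.
Proof. exact: continuous_L2. Qed.

Lemma ip_shift a f g : continuous f -> continuous g ->
  ip (shift a f) (shift a g) = ip f g.
Proof.
move=> cf cg.
have := @cintegral_shift _ _ mu hA hmu (fun x => f x * (g x)^*%C) a; apply.
exact: (continuousMf cf (continuous_conjc cg)).
Qed.

Lemma nn_shift a f : continuous f -> nn (shift a f) = nn f.
Proof. by move=> cf; apply: complexI; rewrite -!ipE ip_shift. Qed.

Lemma nrm_shift a f : continuous f -> nrm (shift a f) = nrm f.
Proof. by move=> cf; congr Num.sqrt; exact: nn_shift. Qed.

Lemma cc_bound f g x : continuous f -> continuous g ->
  normc (cc f g x) <= nrm f * nrm g.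
Proof.
move=> cf cg; rewrite -(nrm_shift x cf).
exact: (cauchy_schwarz_nrm (cL2 (continuous_shift (a := x) cf)) (cL2 cg)).
Qed.

(** The right-hand side involves neither [x] nor anything of [g] but its norm: correlating [f] with
    a bounded set of L2 produces an equicontinuous family. *)
Lemma cc_modulus f g t x : continuous f -> continuous g ->
  normc (cc f g (t + x) - cc f g x) <= nrm (fun y => f (t + y) - f y) * nrm g.
Proof.
move=> cf cg.
have cft := continuousBf (continuous_shift (a := t) cf) cf.
have hs a := cL2 (continuous_shift (a := a) cf).
rewrite -(nrm_shift x cft) /cc -ipBl; [|exact: hs|exact: hs|exact: cL2].
have -> : (fun y => shift (t + x) f y - shift x f y) =
    shift x (fun y => f (t + y) - f y).
  by apply/funext => y; rewrite /shift addrA.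
exact: (cauchy_schwarz_nrm (cL2 (continuous_shift (a := x) cft)) (cL2 cg)).
Qed.

Lemma near_nrm_shift f (e : R) : continuous f -> 0 < e ->
  \forall t \near (0 : A), nrm (fun y => f (t + y) - f y) <= e.
Proof.
move=> cf e0; have := uniform_continuity hA cf e0; apply: filterS => t ht.
apply: le_nrm; first exact: ltW.
- by move=> y; exact/ltW/ht.
- apply: continuous_cmeasurable.
  exact: (continuousBf (continuous_shift (a := t) cf) cf).
Qed.

Lemma near_nrm_shiftM f (C e : R) : continuous f -> 0 <= C -> 0 < e ->
  \forall t \near (0 : A), nrm (fun y => f (t + y) - f y) * C <= e.
Proof.
move=> cf C0 e0; have e1 : 0 < e / (C + 1) by rewrite divr_gt0// ltr_wpDl.
have := near_nrm_shift cf e1; apply: filterS => t ht.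
rewrite (@le_trans _ _ (e / (C + 1) * C))// ?ler_wpM2r//.
by rewrite -mulrA ler_piMr ?ltW// mulrC ltr_pdivrMr ?ltr_wpDl// mul1r ltrDl.
Qed.

Lemma continuous_cc f g : continuous f -> continuous g -> continuous (cc f g).
Proof.
move=> cf cg; apply: continuous_unif => e e0.
have := near_nrm_shiftM cf (nrm_ge0 mu g) e0; apply: filterS => t ht x.
exact: le_trans (cc_modulus _ _ cf cg) ht.
Qed.

Lemma ccDl f g h x : continuous f -> continuous g -> continuous h ->
  cc (fun y => f y + g y) h x = cc f h x + cc g h x.
Proof.
move=> cf cg ch; have hs p (cp : continuous p) := cL2 (continuous_shift (a := x) cp).
by rewrite /cc -ipDl; [|exact: hs|exact: hs|exact: cL2].
Qed.

Lemma ccDr f g h x : continuous f -> continuous g -> continuous h ->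
  cc h (fun y => f y + g y) x = cc h f x + cc h g x.
Proof.
move=> cf cg ch; have hs p (cp : continuous p) := cL2 (continuous_shift (a := x) cp).
by rewrite /cc -ipDr; [|exact: cL2|exact: cL2|exact: hs].
Qed.

Lemma ccZl (c : R[i]) f g x : continuous f -> continuous g ->
  cc (fun y => c * f y) g x = c * cc f g x.
Proof.
move=> cf cg; have hs p (cp : continuous p) := cL2 (continuous_shift (a := x) cp).
by rewrite /cc -ipZl; [|exact: hs|exact: cL2].
Qed.

Lemma ccZr (c : R[i]) f g x : continuous f -> continuous g ->
  cc g (fun y => c * f y) x = c^*%C * cc g f x.
Proof.
move=> cf cg; have hs p (cp : continuous p) := cL2 (continuous_shift (a := x) cp).
by rewrite /cc -ipZr; [|exact: cL2|exact: hs].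
Qed.

Lemma cc_shiftl a f g x : cc (shift a f) g x = cc f g (a + x).
Proof.
by apply: eq_cintegral => y; rewrite /shift addrA.
Qed.

Lemma cc_shiftr a f g x : continuous f -> continuous g ->
  cc f (shift a g) x = cc f g (- a + x).
Proof.
move=> cf cg; rewrite /cc -[RHS](ip_shift a (continuous_shift (a := - a + x) cf) cg).
by apply: eq_cintegral => y; rewrite /shift addrACA addNr add0r.
Qed.

Lemma continuous_add2 f : continuous f ->
  continuous (fun p : A * A => f (p.1 + p.2)).
Proof.
move=> cf p; apply: (@continuous_comp _ _ _ (fun p : A * A => p.1 + p.2)).
  exact: add_continuous.
exact: cf.
Qed.

Lemma continuous_fstf f : continuous f -> continuous (fun p : A * A => f p.1).
Proof.
by move=> cf p; apply: (@continuous_comp _ _ _ fst); [exact: cvg_fst|exact: cf].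
Qed.

Lemma continuous_sndf f : continuous f -> continuous (fun p : A * A => f p.2).
Proof.
by move=> cf p; apply: (@continuous_comp _ _ _ snd); [exact: cvg_snd|exact: cf].
Qed.

(* The kernel [k (x + y)] is symmetric, so [cc k] is an antilinear
   self-adjoint operator. *)
Lemma ip_cc_sym k f g : continuous k -> continuous f -> continuous g ->
  ip (cc k f) g = ip (cc k g) f.
Proof.
move=> ck cf cg.
have cI (q : A -> R[i]) : continuous q -> cintegrable mu q.
  exact: continuous_cintegrable.
have step (p q : A -> R[i]) : continuous p -> continuous q ->
    ip (cc k p) q = cintegral mu (fun x => cintegral mu (fun y =>
      k (x + y) * ((p y)^*%C * (q x)^*%C))).
  move=> cp cq; apply: eq_cintegral => x; rewrite mulrC -cintegralZ.
    by apply: eq_cintegral => y; rewrite /shift; ring.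
  by apply: cI; exact: (continuousMf (continuous_shift (a := x) ck) (continuous_conjc cp)).
rewrite (step _ _ cf cg) (step _ _ cg cf).
pose F (p : A * A) := k (p.1 + p.2) * ((f p.2)^*%C * (g p.1)^*%C).
have cF : continuous F.
  move=> p; apply: cvgM; first exact: (continuous_add2 ck).
  apply: cvgM.
    exact: (continuous_sndf (continuous_conjc cf)).
  exact: (continuous_fstf (continuous_conjc cg)).
rewrite [LHS](cintegral_swap mu hA cF).
apply: eq_cintegral => y; apply: eq_cintegral => x.
by rewrite /F /= [y + x]addrC; congr (_ * _); rewrite mulrC.
Qed.

Lemma continuous_character (chi : dual_group R A) : continuous chi.
Proof. by have [] := characterP chi. Qed.

Lemma characterD (chi : dual_group R A) x y : chi (x + y) = chi x * chi y.
Proof. by have [_ ->] := characterP chi. Qed.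

Lemma normc_character (chi : dual_group R A) x : normc (chi x) = 1.
Proof.
by have [_ _ /(_ x)] := characterP chi; rewrite normr_normc => -[].
Qed.

Lemma mulJ_character (chi : dual_group R A) x : chi x * (chi x)^*%C = 1.
Proof. by rewrite mulcJ normc_character expr1n. Qed.

(** By invariance both arguments may be translated by [x], and a translated character is a
    unimodular multiple of itself. *)
Lemma cc_character f (chi : dual_group R A) x : continuous f ->
  cc f chi x = ip f chi * chi x.
Proof.
move=> cf; have cchi := @continuous_character chi.
rewrite -(ip_shift x cf cchi) mulrC.
have hs p (cp : continuous p) := cL2 (continuous_shift (a := x) cp).
rewrite -ipZl; [|exact: hs|exact: hs].
rewrite /cc; apply: eq_cintegral => y; rewrite /shift characterD conjcM.
by rewrite [RHS]mulrACA mulrA mulJ_character mul1r.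
Qed.

(** Symmetry of the kernel exchanges one copy of [v] with [chi], after which the correlation with
    [chi] is explicit. *)
Lemma ip_autocorrelation v (chi : dual_group R A) : continuous v ->
  ip (cc v v) chi = (normc (ip v chi) ^+ 2)%:C%C.
Proof.
move=> cv; have cchi := @continuous_character chi.
rewrite ip_cc_sym// -mulcJ -[in RHS]ipC; [|exact: cL2|exact: cL2].
rewrite -ipZl; [|exact: cL2|exact: cL2].
by apply: eq_cintegral => x; rewrite cc_character.
Qed.

(** The two diagonal terms coincide because [c] is unimodular; the cross terms are the translates by
    [a] and [- a]. *)
Lemma autocorrelation_comb (c : R[i]) a v x : normc c = 1 -> continuous v ->
  let w y := v y + c * shift a v y in
  cc w w x = 2 * cc v v x + (c * cc v v (a + x) + c^*%C * cc v v (- a + x)).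
Proof.
move=> c1 cv w; have csv := continuous_shift (a := a) cv.
have czv := continuousZf (c := c) csv; have cw := continuousDf cv czv.
rewrite (ccDl x cv czv cw) (ccZl c x csv cw).
rewrite (ccDr x cv czv cv) (ccDr x cv czv csv).
rewrite (ccZr c x csv cv) (ccZr c x csv csv).
rewrite !cc_shiftl !(cc_shiftr a _ cv cv) addKr.
have cc1 : c * c^*%C = 1 by rewrite mulcJ c1 expr1n.
rewrite mulrDr (mulrA c c^*%C) cc1; ring.
Qed.

End cross_correlation.

(** * Existence of characters and Parseval's identity *)

Section extremal_character.
Context {R : realType} {A : topologicalZmodType}.
Variable mu : probability (borel A) R.
Hypotheses (hA : compact_abelian_group A) (hmu : haar mu).
Variable k : A -> R[i].
Hypothesis ck : continuous k.
Implicit Types h : A -> R[i].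

Local Notation ip := (ip mu).
Local Notation nn := (nn mu).
Local Notation nrm := (nrm mu).

Let J h := cc mu k h.
Let U h := cc mu (J h) (J h).

Let cL2 f : continuous f -> L2 mu f.
Proof. exact: continuous_L2. Qed.

Let cJ h : continuous h -> continuous (J h).
Proof. by move=> ch; exact: (continuous_cc hA hmu ck ch). Qed.

Let cU h : continuous h -> continuous (U h).
Proof. by move=> ch; exact: (continuous_cc hA hmu (cJ ch) (cJ ch)). Qed.

Let nrmJ h : continuous h -> nrm (J h) <= nrm k * nrm h.
Proof.
move=> ch; apply: le_nrm; first by rewrite mulr_ge0// nrm_ge0.
  by move=> x; exact: (cc_bound hA hmu x ck ch).
exact: (continuous_cmeasurable (cJ ch)).
Qed.

Let U_bound h x : continuous h -> normc (U h x) <= (nrm k * nrm h) ^+ 2.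
Proof.
move=> ch; apply: (le_trans (cc_bound hA hmu x (cJ ch) (cJ ch))).
by rewrite -expr2 lerXn2r ?nnegrE ?mulr_ge0 ?nrm_ge0// nrmJ.
Qed.

(** The modulus estimate is applied twice, to [J h] as a correlation of [k] and to [U h] as a
    correlation of [J h], so that only the modulus of [k] and the norm of [h] remain. *)
Let U_modulus h t x : continuous h ->
  normc (U h (t + x) - U h x) <=
  nrm (fun y => k (t + y) - k y) * nrm h * (nrm k * nrm h).
Proof.
move=> ch; apply: (le_trans (cc_modulus hA hmu t x (cJ ch) (cJ ch))).
apply: ler_pM; [exact: nrm_ge0|exact: nrm_ge0| |exact: nrmJ].
apply: le_nrm; first by apply: mulr_ge0; exact: nrm_ge0.
  by move=> y; exact: (cc_modulus hA hmu t y ck ch).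
apply: continuous_cmeasurable.
exact: (continuousBf (continuous_shift (a := t) (cJ ch)) (cJ ch)).
Qed.

Let U0 h : U h 0 = (nn (J h))%:C%C.
Proof. by rewrite -ipE; apply: eq_cintegral => y; rewrite /shift add0r. Qed.

Let U_max h x : continuous h -> normc (U h x) <= normc (U h 0).
Proof.
move=> ch; apply: (le_trans (cc_bound hA hmu x (cJ ch) (cJ ch))).
by rewrite U0 normc_real ger0_norm ?nn_ge0// -expr2 sqr_nrm.
Qed.

Let U_scale (s : R) h x : continuous h ->
  U (fun y => s%:C%C * h y) x = (s ^+ 2)%:C%C * U h x.
Proof.
move=> ch; have cs := continuousZf (c := s%:C%C) (cJ ch).
have e : J (fun y => s%:C%C * h y) = (fun y => s%:C%C * J h y).
  by apply/funext => y; rewrite [LHS](ccZr mu hA _ y ch ck) conjc_real.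
rewrite /U e (ccZl mu hA _ x (cJ ch) cs) (ccZr mu hA _ x (cJ ch) (cJ ch)).
by rewrite mulrA conjc_real expr2 (rmorphM (real_complex R)).
Qed.

(** The conjugate and the opposite translation on the left compensate for [J] being antilinear and
    reversing translations: [J] sends the combination to [J h + c (J h)(a + .)]. *)
Let U_comb (c : R[i]) a h x : normc c = 1 -> continuous h ->
  U (fun y => h y + c^*%C * shift (- a) h y) x =
  2 * U h x + (c * U h (a + x) + c^*%C * U h (- a + x)).
Proof.
move=> c1 ch; have cs := continuous_shift (a := - a) ch.
have e : J (fun y => h y + c^*%C * shift (- a) h y) =
    (fun y => J h y + c * shift a (J h) y).
  apply/funext => y; rewrite [LHS](ccDr mu hA y ch (continuousZf (c := c^*%C) cs) ck).
  by rewrite (ccZr mu hA _ y cs ck) conjcK (cc_shiftr hA hmu (- a) y ck ch) opprK.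
by rewrite /U e; exact: autocorrelation_comb (cJ ch).
Qed.

Let S := [set r | exists h, [/\ continuous h, nn h <= 1 & r = nrm (U h)]].

Let S_bound h : continuous h -> nrm (U h) <= (nrm k * nrm h) ^+ 2.
Proof.
move=> ch; apply: le_nrm; first exact: sqr_ge0.
  by move=> x; exact: U_bound.
exact: (continuous_cmeasurable (cU ch)).
Qed.

Let nrm_le1 h : nn h <= 1 -> nrm h <= 1.
Proof. by move=> h1; rewrite -sqrtr1; exact: ler_wsqrtr. Qed.

Let has_supS : has_sup S.
Proof.
split.
  exists (nrm (U (fun=> 0))), (fun=> 0); split.
  - exact: continuous_cst.
  - by rewrite nn0 ler01.
  - by [].
exists (nrm k ^+ 2) => _ [h [ch h1 ->]].
apply: (le_trans (S_bound ch)).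
have := nrm_le1 h1; have := nrm_ge0 mu h; have := nrm_ge0 mu k.
by move=> k0 hn0 hn1; rewrite lerXn2r ?nnegrE ?mulr_ge0// ler_piMr.
Qed.

Let L := sup S.

(** Both sides are homogeneous of degree two in [h], so the bound on the unit ball extends to all
    continuous functions. *)
Let U_le_L h : continuous h -> nrm (U h) <= L * nn h.
Proof.
move=> ch; have [h0|h0] := eqVneq (nn h) 0.
  apply: (le_trans (S_bound ch)).
  by rewrite exprMn !sqr_nrm h0 !mulr0.
have hp : 0 < nn h by rewrite lt_neqAle eq_sym h0 nn_ge0.
pose s := (Num.sqrt (nn h))^-1.
have s2 : s ^+ 2 = (nn h)^-1 by rewrite exprVn sqr_sqrtr// nn_ge0.
have csh := continuousZf (c := s%:C%C) ch.
have : nrm (U (fun y => s%:C%C * h y)) <= L.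
  apply: ub_le_sup; first by have [] := has_supS.
  exists (fun y => s%:C%C * h y); split => //.
  rewrite (nnZ _ (cL2 ch)).
  by rewrite normc_real real_normK ?num_real// s2 mulVf.
have -> : U (fun y => s%:C%C * h y) = (fun x => (s ^+ 2)%:C%C * U h x).
  by apply/funext => x; exact: U_scale.
rewrite (nrmZ _ (cL2 (cU ch))) normc_real s2.
by rewrite ger0_norm ?invr_ge0 ?nn_ge0// mulrC ler_pdivrMr.
Qed.

Let U_near_sup (e : R) : 0 < e ->
  exists h, [/\ continuous h, nn h <= 1 & L - e <= nrm (U h)].
Proof.
move=> e0; have [_ [h [ch h1 ->]] Lh] := sup_adherent e0 has_supS.
by exists h; split => //; exact: ltW.
Qed.

(** The two functions are the [U] of the combinations of [h] with coefficients of opposite sign,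
    whose squared norms add up to [4 * nn h]. They sum to [4 U h], so for a nearly maximizing [h]
    the triangle inequality is nearly an equality. *)
Let U_pair (c : R[i]) a h : normc c = 1 -> continuous h -> nn h <= 1 ->
  nrm (fun x => 2 * U h x + (c * U h (a + x) + c^*%C * U h (- a + x))) +
  nrm (fun x => 2 * U h x - (c * U h (a + x) + c^*%C * U h (- a + x))) <=
  4 * L.
Proof.
move=> c1 ch h1; have cs := continuous_shift (a := - a) ch.
have cz (b : R[i]) := continuousZf (c := b^*%C) cs.
have eqU (b : R[i]) : normc b = 1 ->
    nrm (fun x => 2 * U h x + (b * U h (a + x) + b^*%C * U h (- a + x))) <=
    L * nn (fun y => h y + b^*%C * shift (- a) h y).
  move=> b1; rewrite (_ : (fun x => _) = U (fun y => h y + b^*%C * shift (- a) h y)).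
    exact: (U_le_L (continuousDf ch (cz b))).
  by apply/funext => x; rewrite U_comb.
have e1 := eqU c c1; have := eqU (- c); rewrite normcN => /(_ c1) e2.
have L0 : 0 <= L.
  have S0 : S (nrm (U (fun=> 0))).
    by exists (fun=> 0); split; [exact: continuous_cst|rewrite nn0 ler01|].
  by apply: (le_trans (nrm_ge0 mu _)); apply: ub_le_sup S0; have [] := has_supS.
have E : nn (fun y => h y + c^*%C * shift (- a) h y) +
    nn (fun y => h y + (- c)^*%C * shift (- a) h y) = 4 * nn h.
  rewrite (_ : (fun y => h y + (- c)^*%C * shift (- a) h y) =
    (fun y => h y - c^*%C * shift (- a) h y)); last first.
    by apply/funext => y; rewrite conjcN mulNr.
  rewrite (parallelogram (cL2 ch) (cL2 (cz c))) (nnZ _ (cL2 cs)).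
  by rewrite normcJ c1 expr1n mul1r (nn_shift hA hmu _ ch); ring.
have {}e2 : nrm (fun x => 2 * U h x - (c * U h (a + x) + c^*%C * U h (- a + x))) <=
    L * nn (fun y => h y + (- c)^*%C * shift (- a) h y).
  rewrite (_ : (fun x => _ - _) = (fun x => 2 * U h x +
     (- c * U h (a + x) + (- c)^*%C * U h (- a + x))))//.
  by apply/funext => x; rewrite conjcN !mulNr -opprD.
apply: (le_trans (lerD e1 e2)); rewrite -mulrDr E.
have := nn_ge0 mu h; nra.
Qed.

(** Equality in the triangle inequality forces equality in Cauchy-Schwarz, and then the difference
    of the two sides has norm 0. Cross-multiplying by the norms avoids a case analysis on their
    vanishing; continuity makes the identity pointwise. *)
Lemma nrm_parallel (X Y : A -> R[i]) : continuous X -> continuous Y ->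
  nrm X + nrm Y <= nrm (fun x => X x + Y x) ->
  forall x, (nrm Y)%:C%C * X x = (nrm X)%:C%C * Y x.
Proof.
move=> cX cY h.
have hre : nrm X * nrm Y <= complex.Re (ip X Y).
  have : (nrm X + nrm Y) ^+ 2 <= nn (fun x => X x + Y x).
    by rewrite -sqr_nrm lerXn2r ?nnegrE ?addr_ge0 ?nrm_ge0.
  rewrite (nnD (cL2 cX) (cL2 cY)) sqrrD !sqr_nrm; lra.
have cx := continuousZf (c := (nrm Y)%:C%C) cX.
have cy := continuousZf (c := (nrm X)%:C%C) cY.
have := nn_eq0 hA hmu (continuousBf cx cy); move=> H x; apply/eqP.
rewrite -subr_eq0; apply/eqP; apply: (H _ x).
apply/eqP; rewrite eq_le nn_ge0 andbT.
rewrite (nnB (cL2 cx) (cL2 cy)) (ipZl _ (cL2 cX) (cL2 cy)) (ipZr _ (cL2 cY) (cL2 cX)).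
rewrite (nnZ _ (cL2 cX)) (nnZ _ (cL2 cY)) !normc_real !ger0_norm ?nrm_ge0//.
rewrite conjc_real !ReZ -!sqr_nrm.
have := ler_wpM2l (mulr_ge0 (nrm_ge0 mu X) (nrm_ge0 mu Y)) hre; lra.
Qed.

Let comb_diff (c c' z1 z2 z3 w1 w2 w3 : R[i]) :
  (2 * z1 + (c * z2 + c' * z3)) - (2 * w1 + (c * w2 + c' * w3)) =
  2 * (z1 - w1) + (c * (z2 - w2) + c' * (z3 - w3)).
Proof. by ring. Qed.

Let comb_diff' (c c' z1 z2 z3 w1 w2 w3 : R[i]) :
  (2 * z1 - (c * z2 + c' * z3)) - (2 * w1 - (c * w2 + c' * w3)) =
  2 * (z1 - w1) - (c * (z2 - w2) + c' * (z3 - w3)).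
Proof. by ring. Qed.

(** With [p] and [q] the norms of [2 u + w] and [2 u - w], parallelism of these two functions says
    that [w] is a multiple of [u]. *)
Let parallel_eq (p q z w : R[i]) : q * (2 * z + w) = p * (2 * z - w) ->
  (p + q) * w = (2 * (p - q)) * z.
Proof.
move=> h; apply/eqP; rewrite -subr_eq0.
have -> : (p + q) * w - 2 * (p - q) * z = q * (2 * z + w) - p * (2 * z - w) by ring.
by rewrite h subrr.
Qed.

Let proportional_cross (s d w0 wx z0 zx : R[i]) : s != 0 ->
  s * w0 = d * z0 -> s * wx = d * zx -> wx * z0 = w0 * zx.
Proof.
move=> s0 h0 hx; apply: (mulfI s0); rewrite !mulrA hx h0; ring.
Qed.

(** The relations for [c = 1] and [c = i] give the sum and the difference of the two translates,
    hence each of them. *)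
Let separate (v1 v2 a b z0 zx : R[i]) :
  (v1 + v2) * z0 = (a + b) * zx ->
  ('i%C * v1 + - 'i%C * v2) * z0 = ('i%C * a + - 'i%C * b) * zx ->
  v1 * z0 = a * zx.
Proof.
move=> h1 h2; have i0 : 'i%C != 0 :> R[i].
  by apply/negP => /eqP[] /eqP; rewrite oner_eq0.
have {}h2 : (v1 - v2) * z0 = (a - b) * zx.
  apply: (mulfI i0); rewrite !mulrA -[RHS]/(_ * zx).
  have -> : 'i%C * (v1 - v2) = 'i%C * v1 + - 'i%C * v2 by ring.
  by rewrite h2; ring.
apply: (@mulfI _ (2 : R[i])); first by rewrite pnatr_eq0.
have -> : 2 * (v1 * z0) = (v1 + v2) * z0 + (v1 - v2) * z0 by ring.
by rewrite h1 h2; ring.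
Qed.

Lemma exists_character : nn k != 0 -> exists chi : dual_group R A, ip k chi != 0.
Proof.
move=> k0.
have /choice[h_ hP] : forall n : nat, exists h,
    [/\ continuous h, nn h <= 1 & L - n.+1%:R^-1 <= nrm (U h)].
  by move=> n; apply: U_near_sup; rewrite invr_gt0.
have ch n : continuous (h_ n) by have [] := hP n.
have h1 n : nn (h_ n) <= 1 by have [] := hP n.
have hb n : nrm k * nrm (h_ n) <= nrm k.
  by rewrite ler_piMr ?nrm_ge0 ?nrm_le1.
(* The coefficient of [U h] at [psi] is the squared modulus of that of [J h], which by symmetry is
   the inner product of [J psi] with [h]; and [J psi] is [ip k psi] times [psi]. *)
have ipU (psi : dual_group R A) n : ip k psi = 0 -> ip (U (h_ n)) psi = 0.
  move=> kpsi; have cpsi := @continuous_character _ _ psi.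
  rewrite (ip_autocorrelation hA hmu psi (cJ (ch n))).
  rewrite (ip_cc_sym mu hA ck (ch n) cpsi) (_ : ip _ _ = 0) ?normc0 ?expr0n//.
  rewrite -[RHS](cintegral0 mu); apply: eq_cintegral => x.
  by rewrite (cc_character hA hmu psi x ck) kpsi !mul0r.
(* Tested on [h = k]: [J k] at 0 is [nn k], and [U k] at 0 is [nn (J k)], so neither function
   vanishes identically. *)
have Lk : 0 < L * nn k.
    apply: lt_le_trans (U_le_L ck).
    have nz f : continuous f -> f 0 != 0 -> 0 < nn f.
      move=> cf f0; rewrite lt_neqAle nn_ge0 andbT eq_sym.
      by apply: contra f0 => /eqP /(nn_eq0 hA hmu cf) ->.
    have Jk0 : J k 0 = (nn k)%:C%C.
      by rewrite -ipE; apply: eq_cintegral => y; rewrite /shift add0r.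
    have real0 (r : R) : r != 0 -> r%:C%C != 0 :> R[i].
      by apply: contra => /eqP[->].
    rewrite sqrtr_gt0; apply: (nz _ (cU ck)); rewrite U0.
    by apply: (real0 _); rewrite gt_eqF//; apply: (nz _ (cJ ck)); rewrite Jk0 real0.
have [] := @ascoli_cluster _ _ hA (fun n => U (h_ n)) (nrm k ^+ 2).
- move=> n x; apply: (le_trans (U_bound x (ch n))).
  by rewrite lerXn2r ?nnegrE ?mulr_ge0 ?nrm_ge0.
- move=> e e0; have := near_nrm_shiftM mu hA ck (nrm_ge0 mu k) e0.
  apply: filterS => t ht n x; apply: (le_trans (U_modulus t x (ch n))).
  apply: le_trans ht; have := hb n; have := nrm_le1 (h1 n).
  have := nrm_ge0 mu (h_ n); have := nrm_ge0 mu (fun y => k (t + y) - k y).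
  set a := nrm (fun _ => _); set b := nrm (h_ n); move: (nrm k) => m a0 b0 b1 mb.
  rewrite -mulrA ler_wpM2l// mulrA; nra.
move=> u cu uP; clearbody U J L.
have unf (f g : A -> R[i]) (e : R) : continuous f -> continuous g -> 0 <= e ->
    (forall x, normc (f x - g x) <= e) -> nrm f <= nrm g + e.
  move=> cf cg e0 fg; have cfg := continuousBf cf cg.
  have -> : nrm f = nrm (fun x => g x + (f x - g x)).
    by congr (nrm _); apply/funext => x; ring.
  apply: (le_trans (minkowski (cL2 cg) (cL2 cfg))); rewrite lerD2l.
  by apply: le_nrm => //; exact: (continuous_cmeasurable cfg).
(* Uniform closeness to arbitrarily late, hence nearly maximizing, terms of the sequence. *)
have Lu : L <= nrm u.
  apply/ler_addgt0Pr => e e0; have e2 : 0 < e / 2 by rewrite divr_gt0.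
  have [N _ HN] := near_infty_natSinv_lt (PosNum e2).
  have [n Nn hn] := uP _ N e2; have [_ _ hL] := hP n.
  have := unf _ _ _ (cU (ch n)) cu (ltW e2) hn.
  have hN : n.+1%:R^-1 < e / 2 := HN n Nn.
  move: (n.+1%:R^-1) hN hL => r hN hL hu; lra.
have u_pos : 0 < nrm u.
  have := nn_ge0 mu k; move: Lk; nra.
(* An autocorrelation is largest at 0, and this survives in the limit. It gives [u 0 != 0], and
   later the bound of [chi] by 1. *)
have u_max x : normc (u x) <= normc (u 0).
  apply/ler_addgt0Pr => e e0; have e2 : 0 < e / 2 by rewrite divr_gt0.
  have [n _ hn] := uP _ 0 e2; have := hn x; have := hn 0; have := U_max x (ch n).
  have := normc_triangle (U (h_ n) 0 - u 0) (u 0).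
  have := normcB_triangle (U (h_ n) x) (U (h_ n) x - u x).
  rewrite subrK subKr; norm_lra.
have u00 : u 0 != 0.
  apply/negP => /eqP u0; have : nrm u <= 0.
    apply: le_nrm => //; first by move=> x; rewrite (le_trans (u_max x))// u0 normc0.
    exact: (continuous_cmeasurable cu).
  by rewrite leNgt u_pos.
have key (c : R[i]) a x : normc c = 1 ->
    (c * u (a + x) + c^*%C * u (- a + x)) * u 0 =
    (c * u a + c^*%C * u (- a)) * u x.
  move=> c1; pose w x := c * u (a + x) + c^*%C * u (- a + x).
  have cw : continuous w.
    apply: continuousDf.
      exact: (continuousZf (continuous_shift (a := a) cu)).
    exact: (continuousZf (continuous_shift (a := - a) cu)).
  pose X x := 2 * u x + w x; pose Y x := 2 * u x - w x.
  have c2u := continuousZf (c := 2) cu.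
  have cX : continuous X := continuousDf c2u cw.
  have cY : continuous Y := continuousBf c2u cw.
  have XY : nrm X + nrm Y <= 4 * nrm u.
    (* An error [e / 8] on [u] costs at most [e / 4 + e / 8 + e / 8] on each of [X] and [Y], thus
       [e] in total. *)
    apply/ler_addgt0Pr => e e0; have e8 : 0 < e / 8 by rewrite divr_gt0.
    have [n _ hn] := uP _ 0 e8; have := U_pair a c1 (ch n) (h1 n).
    set Xn := (fun x => _ + _); set Yn := (fun x => _ - _) => Ln.
    have cUn := cU (ch n).
    have cwn : continuous (fun x => c * U (h_ n) (a + x) + c^*%C * U (h_ n) (- a + x)).
      apply: continuousDf.
        exact: (continuousZf (continuous_shift (a := a) cUn)).
      exact: (continuousZf (continuous_shift (a := - a) cUn)).
    have cXn : continuous Xn := continuousDf (continuousZf (c := 2) cUn) cwn.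
    have cYn : continuous Yn := continuousBf (continuousZf (c := 2) cUn) cwn.
    have d0 y : normc (2 * (u y - U (h_ n) y)) <= e / 4.
      rewrite normcM (normc_nat 2).
      by have := hn y; rewrite distcC; norm_lra.
    have d1 y : normc (c * (u (a + y) - U (h_ n) (a + y))) <= e / 8.
      by rewrite normcM c1 mul1r distcC.
    have d2 y : normc (c^*%C * (u (- a + y) - U (h_ n) (- a + y))) <= e / 8.
      by rewrite normcM normcJ c1 mul1r distcC.
    have e_split : e / 2 = e / 4 + (e / 8 + e / 8) by field.
    have dX y : normc (X y - Xn y) <= e / 2.
      rewrite [X y - Xn y](comb_diff c c^*%C).
      apply: (le_trans (normc_triangle _ _)); rewrite e_split.
      apply: lerD (d0 y) _; apply: (le_trans (normc_triangle _ _)).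
      exact: lerD (d1 y) (d2 y).
    have dY y : normc (Y y - Yn y) <= e / 2.
      rewrite [Y y - Yn y](comb_diff' c c^*%C).
      apply: (le_trans (normcB_triangle _ _)); rewrite e_split.
      apply: lerD (d0 y) _; apply: (le_trans (normc_triangle _ _)).
      exact: lerD (d1 y) (d2 y).
    have e2 : 0 <= e / 2 by rewrite divr_ge0 ?ltW.
    have := unf _ _ _ cX cXn e2 dX; have := unf _ _ _ cY cYn e2 dY.
    move: Ln Lu; norm_lra.
  (* The terms [w] cancel, so the upper bound [XY] is the reverse triangle inequality required by
     [nrm_parallel]. *)
  have XYE : nrm (fun x => X x + Y x) = 4 * nrm u.
    rewrite (_ : (fun x => X x + Y x) = (fun x => 4%:C%C * u x)).
      by rewrite (nrmZ _ (cL2 cu)) normc_real ger0_norm.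
    by apply/funext => y; rewrite /X /Y (rmorph_nat (real_complex R) 4); ring.
  have par : forall x, (nrm Y)%:C%C * X x = (nrm X)%:C%C * Y x.
    by apply: (nrm_parallel cX cY); rewrite XYE.
  have ab : 0 < nrm X + nrm Y.
    have := minkowski (cL2 cX) (cL2 cY); rewrite XYE; move: u_pos; norm_lra.
  have ab0 : (nrm X + nrm Y)%:C%C != 0 :> R[i].
    by apply/negP => /eqP[] h; rewrite h ltxx in ab.
  have wu y : (nrm X + nrm Y)%:C%C * w y = (2 * ((nrm X)%:C%C - (nrm Y)%:C%C)) * u y.
    rewrite (rmorphD (real_complex R)); exact: (parallel_eq (par y)).
  have w0 := wu 0; rewrite /w !addr0 in w0.
  exact: (proportional_cross ab0 w0 (wu x)).
have uD a x : u (a + x) * u 0 = u a * u x.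
  have k1 := key 1 a x; rewrite normc1 in k1; have {}k1 := k1 erefl.
  have ki := key 'i%C a x; have ni : normc ('i%C : R[i]) = 1.
    by rewrite /= expr0n /= add0r expr1n sqrtr1.
  have {}ki := ki ni; rewrite conjc1 !mul1r in k1.
  have ci : ('i%C : R[i])^*%C = - 'i%C by congr Complex; rewrite oppr0.
  by rewrite ci in ki; exact: separate k1 ki.
pose chi x := u x / u 0.
have chiD x y : chi (x + y) = chi x * chi y.
  rewrite /chi; apply: (mulIf u00); apply: (mulIf u00).
  by rewrite divfK// uD; field.
have chi1 x : normc (chi x) <= 1.
  rewrite normcM normcV ler_pdivrMr ?mul1r//.
  by rewrite lt_neqAle normc_ge0 andbT eq_sym; apply: contra u00 => /eqP /eq0_normc ->.
have chi0 : chi 0 = 1 by rewrite /chi divff.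
have chic : continuous chi.
  rewrite /chi; under eq_fun do rewrite mulrC.
  exact: (continuousZf cu).
have ischi : is_character chi.
  split=> // x; rewrite normr_normc; congr (_%:C)%C; apply/eqP.
  rewrite eq_le chi1 /=.
  (* Two numbers of [[0, 1]] with product 1 are both 1. *)
  have : normc (chi x) * normc (chi (- x)) = 1.
    by rewrite -normcM -chiD subrr chi0 normc1.
  have := chi1 x; have := chi1 (- x); have := normc_ge0 (chi x); nra.
exists (Dual ischi); apply/negP => /eqP kchi.
have {}ipU n : ip (U (h_ n)) chi = 0 := ipU (Dual ischi) n kchi.
have nchi : nrm chi <= 1.
  by apply: le_nrm => //; exact: (continuous_cmeasurable chic).
(* If [k] were orthogonal to [chi], so would be every [U (h_ n)] and their limit [u]; but
   [u = u 0 * chi] has coefficient [u 0]. *)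
have : normc (ip u chi) <= 0.
  apply/ler_addgt0Pr => e e0; have [n _ hn] := uP _ 0 e0.
  have cd := continuousBf (cU (ch n)) cu.
  have := cauchy_schwarz_nrm (cL2 cd) (cL2 chic).
  rewrite (ipBl (cL2 (cU (ch n))) (cL2 cu) (cL2 chic)) ipU sub0r normcN add0r.
  move=> h; apply: (le_trans h).
  have : nrm (fun x => U (h_ n) x - u x) <= e.
    apply: le_nrm; [exact: ltW|exact: hn|exact: (continuous_cmeasurable cd)].
  have := nrm_ge0 mu chi; have := nrm_ge0 mu (fun x => U (h_ n) x - u x); nra.
have -> : ip u chi = u 0.
  rewrite -[RHS](cintegral_cst mu); apply: eq_cintegral => x.
  have -> : u x = u 0 * chi x by rewrite /chi mulrC divfK.
  by rewrite -mulrA (mulJ_character (Dual ischi)) mulr1.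
move=> u0; have /eq0_normc /eqP : normc (u 0) = 0.
  by apply/eqP; rewrite eq_le u0 normc_ge0.
by rewrite (negbTE u00).
Qed.

End extremal_character.

(** * Orthogonality of characters and Parseval for continuous functions *)

Section parseval.
Context {R : realType} {A : topologicalZmodType}.
Variable mu : probability (borel A) R.
Hypotheses (hA : compact_abelian_group A) (hmu : haar mu).
Implicit Types (f h : A -> R[i]) (F : seq (dual_group R A))
  (b : dual_group R A -> R[i]).

Local Notation ip := (ip mu).
Local Notation nn := (nn mu).
Local Notation nrm := (nrm mu).

Definition trigpoly F b : A -> R[i] := fun x => \sum_(chi <- F) b chi * chi x.

Lemma L2_character (chi : dual_group R A) : L2 mu chi.
Proof. exact: (continuous_L2 mu hA (continuous_character (chi := chi))). Qed.

Lemma continuous_trigpoly F b : continuous (trigpoly F b).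
Proof.
elim: F => [|chi F ih].
  rewrite (_ : trigpoly _ _ = fun=> 0); first exact: continuous_cst.
  by apply/funext => x; rewrite /trigpoly big_nil.
rewrite (_ : trigpoly _ _ = fun x => b chi * chi x + trigpoly F b x).
  exact: (continuousDf (continuousZf (continuous_character (chi := chi))) ih).
by apply/funext => x; rewrite /trigpoly big_cons.
Qed.

Lemma L2_trigpoly F b : L2 mu (trigpoly F b).
Proof. exact: (continuous_L2 mu hA (continuous_trigpoly (F := F) (b := b))). Qed.

(** Translating [chi] by [a] multiplies the inner product by [chi a], while [cc_character]
    multiplies it by [psi a]; if it is nonzero, the two characters agree. *)
Lemma ip_character (chi psi : dual_group R A) :
  ip chi psi = (chi == psi)%:R.
Proof.
have [<-|chipsi] := eqVneq chi psi.
  rewrite -[RHS](cintegral_cst mu); apply: eq_cintegral => x.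
  exact: mulJ_character.
apply/eqP; apply: contraNT chipsi => c0; apply/eqP/dual_eq => a.
have cchi := continuous_character (chi := chi).
have := cc_character hA hmu psi a cchi; rewrite /cc.
have -> : shift a chi = fun x => chi a * chi x.
  by apply/funext => x; rewrite /shift characterD.
rewrite (ipZl _ (L2_character chi) (L2_character psi)) mulrC.
exact: mulfI c0 _ _.
Qed.

Lemma ip_trigpoly F b f : L2 mu f ->
  ip f (trigpoly F b) = \sum_(chi <- F) (b chi)^*%C * ip f chi.
Proof.
move=> hf; rewrite /trigpoly (ip_sumr F (fun chi => L2Z (b chi) (L2_character chi)) hf).
by apply: eq_bigr => chi _; rewrite (ipZr _ (L2_character chi) hf).
Qed.

Lemma trigpoly_ip F b (psi : dual_group R A) : uniq F ->
  ip (trigpoly F b) psi = if psi \in F then b psi else 0.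
Proof.
move=> uF; rewrite /trigpoly.
rewrite (ip_suml F (fun chi => L2Z (b chi) (L2_character chi)) (L2_character psi)).
transitivity (\sum_(chi <- F) b chi * (chi == psi)%:R).
  apply: eq_bigr => chi _.
  by rewrite (ipZl _ (L2_character chi) (L2_character psi)) ip_character.
case: ifPn => pF; last first.
  rewrite big_seq big1// => chi chiF; case: eqVneq => [e|]; last by rewrite mulr0.
  by rewrite -e chiF in pF.
rewrite (bigD1_seq psi)//= eqxx mulr1 big1 ?addr0// => chi /negbTE ->.
by rewrite mulr0.
Qed.

Lemma nn_trigpoly F b : uniq F ->
  nn (trigpoly F b) = \sum_(chi <- F) normc (b chi) ^+ 2.
Proof.
move=> uF; apply: complexI; rewrite -ipE (ip_trigpoly F b (L2_trigpoly F b)).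
rewrite (rmorph_sum (real_complex R)) big_seq [RHS]big_seq.
by apply: eq_bigr => chi chiF; rewrite trigpoly_ip// chiF mulrC mulcJ.
Qed.

Lemma nn_sub_trigpoly F b f : uniq F -> L2 mu f ->
  nn (fun x => f x - trigpoly F b x) = nn f +
    \sum_(chi <- F) normc (b chi) ^+ 2 -
    2 * complex.Re (\sum_(chi <- F) (b chi)^*%C * ip f chi).
Proof.
by move=> uF hf; rewrite (nnB hf (L2_trigpoly F b)) nn_trigpoly// ip_trigpoly.
Qed.

Lemma nn_sub_projection F f : uniq F -> L2 mu f ->
  nn (fun x => f x - trigpoly F (ip f) x) =
  nn f - \sum_(chi <- F) normc (ip f chi) ^+ 2.
Proof.
move=> uF hf; rewrite nn_sub_trigpoly//.
rewrite (_ : \sum_(chi <- F) (ip f chi)^*%C * ip f chi =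
  (\sum_(chi <- F) normc (ip f chi) ^+ 2)%:C%C) /=; last first.
  rewrite (rmorph_sum (real_complex R)); apply: eq_bigr => chi _.
  by rewrite mulrC mulcJ.
by ring.
Qed.

Lemma bessel F f : uniq F -> L2 mu f ->
  \sum_(chi <- F) normc (ip f chi) ^+ 2 <= nn f.
Proof. by move=> uF hf; rewrite -subr_ge0 -nn_sub_projection// nn_ge0. Qed.

Lemma ip_shiftl t f (chi : dual_group R A) : continuous f -> ip (shift t f) chi = ip f chi * chi t.
Proof. exact: cc_character. Qed.

Let energy h F := \sum_(chi <- F) normc (ip h (chi : dual_group R A)) ^+ 2.

(** If the captured energy stayed below [nn h], the autocorrelations of the remainders [g n] would
    cluster at a nonzero [G]. All coefficients of [G] vanish, since a character with a sizeable
    coefficient outside [F_ n] would push the energy past its supremum; this contradicts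
    [exists_character]. *)
Lemma continuous_parseval h (e : R) : continuous h -> 0 < e ->
  exists2 F : seq (dual_group R A), uniq F &
    nn h <= \sum_(chi <- F) normc (ip h chi) ^+ 2 + e.
Proof.
move=> ch e0; have hh := continuous_L2 mu hA ch.
pose S := [set r | exists2 F, uniq F & r = energy h F].
have supS : has_sup S.
  split; first by exists (energy h [::]), [::].
  by exists (nn h) => _ [F uF ->]; exact: bessel.
have le_sup F : uniq F -> energy h F <= sup S.
  by move=> uF; apply: ub_le_sup; [have [] := supS|exists F].
suff Sh : nn h <= sup S.
  have [_ [F uF ->] SF] := sup_adherent e0 supS; exists F => //.
  by move: SF; rewrite -/(energy h F) ltrBlDr => /ltW; exact: le_trans.
have /choice[F_ FP] : forall n : nat, exists F, uniq F /\ sup S - n.+1%:R^-1 <= energy h F.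
  move=> n; have n0 : (0 : R) < n.+1%:R^-1 by rewrite invr_gt0.
  have [_ [F uF ->] SF] := sup_adherent n0 supS.
  by exists F; split => //; exact: ltW.
have uF n : uniq (F_ n) by have [] := FP n.
pose g n x := h x - trigpoly (F_ n) (ip h) x.
have cg n : continuous (g n).
  exact: (continuousBf ch (continuous_trigpoly (F := F_ n) (b := ip h))).
have gh n : nn (g n) = nn h - energy h (F_ n) := nn_sub_projection (uF n) hh.
have E0 n : 0 <= energy h (F_ n).
  by apply: sumr_ge0 => chi _; exact: sqr_ge0.
have nrm_mono f1 f2 : nn f1 <= nn f2 -> nrm f1 <= nrm f2.
  by move=> h12; exact: ler_wsqrtr.
have ngh n : nrm (g n) <= nrm h by apply: nrm_mono; rewrite gh; have := E0 n; lra.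
(* Projections onto characters commute with translations, so the difference on the left is the
   remainder of [w], and a projection remainder is no longer than the function. The modulus obtained
   is uniform in [n]. *)
have gmod n t : nrm (fun y => g n (t + y) - g n y) <= nrm (fun y => h (t + y) - h y).
  apply: nrm_mono; pose w y := shift t h y - h y.
  have cw : continuous w := continuousBf (continuous_shift (a := t) ch) ch.
  have hw := continuous_L2 mu hA cw.
  have ipw (chi : dual_group R A) : ip w chi = ip h chi * chi t - ip h chi.
    have hs := continuous_L2 mu hA (continuous_shift (a := t) ch).
    by rewrite (ipBl hs hh (L2_character chi)) (ip_shiftl t chi ch).
  rewrite (_ : (fun y => _) = (fun y => w y - trigpoly (F_ n) (ip w) y)).
    by rewrite (nn_sub_projection (uF n) hw) gerBl; apply: sumr_ge0 => chi _; exact: sqr_ge0.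
  apply/funext => y; rewrite /g /w /shift.
  have -> : trigpoly (F_ n) (ip w) y = trigpoly (F_ n) (ip h) (t + y) -
      trigpoly (F_ n) (ip h) y.
    rewrite /trigpoly -sumrB; apply: eq_bigr => chi _.
    by rewrite ipw characterD mulrBl mulrA.
  by move: (h (t + y)) (h y) (trigpoly _ _ _) (trigpoly _ _ _) => z1 z2 z3 z4; ring.
have [] := @ascoli_cluster _ _ hA (fun n => cc mu (g n) (g n)) (nrm h * nrm h).
- move=> n x; apply: (le_trans (cc_bound hA hmu x (cg n) (cg n))).
  by apply: ler_pM; rewrite ?nrm_ge0.
- move=> d d0; have := near_nrm_shiftM mu hA ch (nrm_ge0 mu h) d0.
  apply: filterS => t ht n x.
  apply: (le_trans (cc_modulus hA hmu t x (cg n) (cg n))); apply: le_trans ht.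
  by apply: ler_pM; rewrite ?nrm_ge0.
move=> G cG GP.
have cgg n := continuous_cc hA hmu (cg n) (cg n).
rewrite leNgt; apply/negP => hS.
have G0 : nn G != 0.
  apply/negP => /eqP /(nn_eq0 hA hmu cG) /(_ 0) G00.
  (* Half of the missing energy: [nn (g n)] is at least [2 d] for all [n], so it cannot be within
     [d] of 0. *)
  pose d := (nn h - sup S) / 2; have d0 : 0 < d by rewrite divr_gt0// subr_gt0.
  have [n _ hn] := GP d 0 d0; have := hn 0; rewrite G00 subr0.
  have -> : cc mu (g n) (g n) 0 = (nn (g n))%:C%C.
    by rewrite -ipE; apply: eq_cintegral => y; rewrite /shift add0r.
  rewrite normc_real ger0_norm ?nn_ge0// gh.
  have := le_sup _ (uF n); move: hS; rewrite /d.
  by move: (nn h) (energy _ _) (sup S) => r1 r2 r3; lra.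
have [chi] := exists_character hA hmu cG G0; apply/negP; rewrite negbK.
apply/eqP/eq0_normc/eqP; rewrite eq_le normc_ge0 andbT.
have nchi : nrm chi = 1.
  apply/eqP; rewrite -(@eqrXn2 _ 2)// ?nrm_ge0// sqr_nrm expr1n; apply/eqP.
  by apply: complexI; rewrite -ipE ip_character eqxx.
apply/ler_addgt0Pr => d d0; rewrite add0r.
have d2 : 0 < d / 2 by rewrite divr_gt0.
have [N _ HN] := near_infty_natSinv_lt (PosNum d2).
have [n Nn hn] := GP _ N d2; have hN : n.+1%:R^-1 < d / 2 := HN n Nn.
have hG := continuous_L2 mu hA cG; have hgg := continuous_L2 mu hA (cgg n).
(* Either [chi] is in [F_ n] and the remainder has no such coefficient, or adding [chi] to [F_ n]
   gains at most the defect of [F_ n] from the supremum. *)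
have ipgg : normc (ip (cc mu (g n) (g n)) chi) <= n.+1%:R^-1.
  rewrite (ip_autocorrelation hA hmu chi (cg n)) normc_real ger0_norm ?sqr_ge0//.
  rewrite (ipBl hh (L2_trigpoly (F_ n) (ip h)) (L2_character chi)) trigpoly_ip//.
  case: ifPn => chiF; first by rewrite subrr normc0 expr0n invr_ge0.
  have uF' : uniq (chi :: F_ n) by rewrite /= chiF uF.
  have := le_sup _ uF'; rewrite /energy big_cons subr0 -/(energy h (F_ n)).
  have [_] := FP n; move: (n.+1%:R^-1) (energy _ _) (sup S) => r1 r2 r3.
  by move: (normc _ ^+ 2) => r4; lra.
have cd := continuousBf (cgg n) cG.
have := cauchy_schwarz_nrm (continuous_L2 mu hA cd) (L2_character chi).
rewrite (ipBl hgg hG (L2_character chi)) nchi mulr1 => h1.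
have h2 : nrm (fun x => cc mu (g n) (g n) x - G x) <= d / 2.
  by apply: le_nrm; [exact: ltW|exact: hn|exact: (continuous_cmeasurable cd)].
have := normcB_triangle (ip (cc mu (g n) (g n)) chi)
  (ip (cc mu (g n) (g n)) chi - ip G chi).
rewrite subKr => h3; apply: (le_trans h3); rewrite (splitr d); apply: lerD.
  exact: le_trans ipgg (ltW hN).
exact: le_trans h1 h2.
Qed.

End parseval.

Import HBSimple HBNNSimple.

(** * Density of continuous functions in L2 *)

Section density.
Context {R : realType} {A : topologicalZmodType}.
Variable mu : probability (borel A) R.
Hypothesis hA : compact_abelian_group A.
Implicit Types (f h : A -> R[i]) (U E : set A).

Local Notation nn := (nn mu).
Local Notation nrm := (nrm mu).

Let cL2 f : continuous f -> L2 mu f.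
Proof. exact: continuous_L2. Qed.

Definition continuous_approx f := L2 mu f /\
  forall e : R, 0 < e -> exists2 h, continuous h & nrm (fun x => f x - h x) <= e.

Lemma continuous_approx_cont f : continuous f -> continuous_approx f.
Proof.
move=> cf; split; first exact: cL2.
move=> e e0; exists f => //; apply: le_nrm; first exact: ltW.
  by move=> x; rewrite subrr normc0 ltW.
apply: continuous_cmeasurable; exact: (continuousBf cf cf).
Qed.

Lemma continuous_approx_lim f : L2 mu f ->
  (forall e : R, 0 < e ->
    exists2 g, continuous_approx g & nrm (fun x => f x - g x) <= e) ->
  continuous_approx f.
Proof.
move=> hf H; split => // e e0; have e2 : 0 < e / 2 by rewrite divr_gt0.
have [g [hg Hg] fg] := H _ e2; have [h ch gh] := Hg _ e2.
exists h => //; have hh := cL2 ch.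
have := minkowski (L2B hf hg) (L2B hg hh).
under [X in nrm X <= _]eq_fun do rewrite addrA subrK.
by move=> /le_trans; apply; rewrite (splitr e) lerD.
Qed.

Lemma continuous_approxD f g : continuous_approx f -> continuous_approx g ->
  continuous_approx (fun x => f x + g x).
Proof.
move=> [hf Hf] [hg Hg]; split; first exact: L2D.
move=> e e0; have e2 : 0 < e / 2 by rewrite divr_gt0.
have [h ch fh] := Hf _ e2; have [k ck gk] := Hg _ e2.
exists (fun x => h x + k x); first exact: (continuousDf ch ck).
have := minkowski (L2B hf (cL2 ch)) (L2B hg (cL2 ck)).
under [X in nrm X <= _]eq_fun do rewrite addrACA -opprD.
by move=> /le_trans; apply; rewrite (splitr e) lerD.
Qed.

Lemma continuous_approxZ (c : R[i]) f : continuous_approx f ->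
  continuous_approx (fun x => c * f x).
Proof.
move=> [hf Hf]; split; first exact: L2Z.
move=> e e0; have c0 := normc_ge0 c.
have e2 : 0 < e / (normc c + 1) by rewrite divr_gt0// ltr_wpDl.
have [h ch fh] := Hf _ e2; exists (fun x => c * h x); first exact: (continuousZf ch).
under eq_fun do rewrite -mulrBr.
rewrite (nrmZ _ (L2B hf (cL2 ch))); apply: (@le_trans _ _ (normc c * (e / (normc c + 1)))).
  by rewrite ler_wpM2l.
by rewrite mulrCA ger_pMr// ler_pdivrMr ?ltr_wpDl// mul1r lerDl.
Qed.

Lemma continuous_approx_sum (I : Type) (s : seq I) (F : I -> A -> R[i]) :
  (forall i, continuous_approx (F i)) ->
  continuous_approx (fun x => \sum_(i <- s) F i x).
Proof.
move=> hF; elim: s => [|i s ih].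
  under eq_fun do rewrite big_nil.
  exact: (continuous_approx_cont (@continuous_cst R A 0)).
by under eq_fun do rewrite big_cons; exact: continuous_approxD.
Qed.

Lemma continuous_approx_dominated f (g : nat -> A -> R[i]) (G : A -> R) :
  L2 mu f -> (forall n, continuous_approx (g n)) ->
  mu.-integrable setT (fun x : borel A => (G x)%:E) ->
  (forall n x, normc (g n x - f x) ^+ 2 <= G x) ->
  (forall x, normc (g n x - f x) @[n --> \oo] --> (0 : R)) ->
  continuous_approx f.
Proof.
move=> hf hg iG gG gf; apply: (continuous_approx_lim hf) => e e0.
have md n : cmeasurable (fun x : borel A => g n x - f x).
  by have [] := L2B (proj1 (hg n)) hf.
have mF n : measurable_fun [set: borel A]
    (fun x : borel A => (normc (g n x - f x) ^+ 2)%:E).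
  by apply/measurable_EFinP; exact: cmeasurable_normc_sqr.
have [||||_ _] := @dominated_convergence _ _ _ mu setT measurableT
    (fun n (x : borel A) => (normc (g n x - f x) ^+ 2)%:E) (fun=> 0%E)
    (fun x : borel A => (G x)%:E) mF => //.
- apply: aeW => x _; apply: cvg_EFin; first by near=> n.
  rewrite -[X in _ --> X](expr0n R 2) -[X in _ --> X]/(0 ^+ 2).
  under eq_fun do rewrite expr2.
  rewrite expr2; apply: cvgM; exact: gf.
- by apply: aeW => x n _ /=; rewrite lee_fin ger0_norm ?sqr_ge0.
rewrite integral0 => /fine_cvg /cvgrPdist_lt /(_ (e ^+ 2)).
move=> /(_ (exprn_gt0 2 e0)) [N _ /(_ N (leqnn N))].
rewrite /= sub0r normrN => h; exists (g N) => //.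
rewrite -(@ler_pXn2r _ 2) ?nnegrE ?nrm_ge0 ?ltW// sqr_nrm.
have -> : nn (fun x => f x - g N x) = nn (fun x => g N x - f x).
  by rewrite -nnN; under eq_fun do rewrite opprB.
exact: (le_lt_trans (ler_norm _) h).
Unshelve. all: by end_near. Qed.

Let ind E : A -> R[i] := fun x => (\1_E x)%:C%C.

Let ind_bound E x : normc (ind E x) <= 1.
Proof. by rewrite /ind normc_real indicE; case: (x \in E); rewrite ?normr1 ?normr0. Qed.

Let cmeasurable_ind E : measurable (E : set (borel A)) ->
  @cmeasurable R _ (borel A) (ind E).
Proof.
move=> mE; split => /=; last exact: measurable_cst.
exact: (@measurable_indic _ (borel A) R setT E mE).
Qed.

Let L2_ind E : measurable (E : set (borel A)) -> L2 mu (ind E).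
Proof.
by move=> mE; apply: (@L2_bounded _ _ _ mu _ 1) (cmeasurable_ind mE) _ => x.
Qed.

Let integrable_cst (c : R) : mu.-integrable setT (fun x : borel A => c%:E).
Proof. exact: finite_measure_integrable_cst. Qed.

(** [U] is exhausted by the countably many basic sets on which some Urysohn function supported in
    [U] exceeds 1/2; truncated sums of these functions tend pointwise to the indicator. *)
Let open_approx U : open U -> continuous_approx (ind U).
Proof.
move=> oU; have [hau cA [B cB [oB bB]]] := hA.
pose good (g : A -> R) (V : set A) := [/\ continuous g, forall x, 0 <= g x,
  forall x, ~ U x -> g x = 0 & forall x, V x -> 2^-1 < g x].
pose D := [set V | B V /\ exists g, good g V].
have UD x : U x -> exists2 V, D V & V x.
  move=> Ux; have nA := compact_normal hau cA.
  have cU : closed (~` U) by rewrite closedC.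
  have cx := accessible_closed_set1 (hausdorff_accessible hau) (x := x).
  have [] := urysohn_ext_itv (R := R) nA cU cx _ (@ltr01 R).
    by apply/seteqP; split => // y [Uy /= yx]; apply: Uy; rewrite yx.
  move=> g [cg g0 g1 gr].
  have ox : open (g @^-1` [set r | 2^-1 < r]).
    by move/continuousP : cg; apply; exact: open_gt.
  have nx : nbhs x (g @^-1` [set r | 2^-1 < r]).
    apply: open_nbhs_nbhs; split => //=; rewrite (g1 (g x)); last by exists x.
    by rewrite invf_lt1 ?ltr1n.
  have [V [BV Vx] Vg] := bB x _ nx; exists V => //; split => //; exists g.
  split => //; first by move=> y; have := gr (g y) (ex_intro2 _ _ y I erefl); rewrite /= in_itv /= => /andP[].
  by move=> y Uy; apply: (g0 (g y)); exists y.
have cD : countable D by apply: sub_countable cB; apply: subset_card_le => V [].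
move/pfcard_geP : cD => [D0|[s]].
  rewrite (_ : ind U = fun=> 0); first exact: (continuous_approx_cont (@continuous_cst R A 0)).
  apply/funext => x; rewrite /ind indicE; case: (boolP (x \in U)) => //.
  by rewrite inE => /UD[V]; rewrite D0.
have /choice[g gP] : forall n, exists g, good g (s n).
  by move=> n; have [] : D (s n) by exact: funS.
(* The factor 2 makes [t n x] at least 1 as soon as one summand exceeds 1/2; [phi] is the minimum
   with 1 on the real line. *)
pose t n x := 2 * \sum_(k < n) g k x.
pose phi (r : R) := (1 + r - `|1 - r|) / 2.
have ct n : continuous (t n).
  move=> x; apply: cvgM; first exact: cvg_cst.
  elim: n => [|n ih].
    rewrite /continuous_at big_ord0; under eq_fun do rewrite big_ord0; exact: cvg_cst.
  rewrite /continuous_at big_ord_recr; under eq_fun do rewrite big_ord_recr.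
  by apply: cvgD => //; have [cg _ _ _] := gP n; exact: cg.
have cphi : continuous phi.
  move=> r; apply: cvgM; last exact: cvg_cst.
  apply: cvgB; first by apply: cvgD; [exact: cvg_cst|exact: cvg_id].
  by apply: cvg_norm; apply: cvgB; [exact: cvg_cst|exact: cvg_id].
have t0 n x : 0 <= t n x.
  by rewrite mulr_ge0// sumr_ge0// => k _; have [_ h _ _] := gP k; exact: h.
have phi01 r : 0 <= r -> 0 <= phi r <= 1.
  move=> r0; rewrite /phi; have [h|h] := lerP 0 (1 - r).
    by rewrite ger0_norm//; lra.
  by rewrite ltr0_norm//; lra.
have phi1 r : 1 <= r -> phi r = 1.
  by move=> r1; rewrite /phi ler0_norm ?subr_le0//; field.
pose h n x := (phi (t n x))%:C%C.
have ch n : continuous (h n).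
  apply/continuous_ReIm; split => x /=; last exact: cvg_cst.
  by apply: continuous_comp; [exact: ct|exact: cphi].
apply: (@continuous_approx_dominated _ h (fun=> 4)).
- exact: (L2_ind (open_borel oU)).
- by move=> n; exact: (continuous_approx_cont (ch n)).
- exact: integrable_cst.
- move=> n x; have b1 := ind_bound U x.
  have b2 : normc (h n x) <= 1.
    by rewrite normc_real; have /andP[p0 p1] := phi01 _ (t0 n x); rewrite ger0_norm.
  exact: sqr_normcB_le4.
- move=> x; apply: cvg_near_cst; have [Ux|Ux] := pselect (U x).
    have [V DV Vx] := UD x Ux; have [k _ sk] := @surj _ _ _ _ s V DV.
    exists k.+1 => // n kn; rewrite /= in kn; suff -> : h n x = ind U x by rewrite subrr normc0.
    rewrite /h /ind indicE mem_set// phi1//.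
    have [_ _ _ gk] := gP k; have gx : 2^-1 < g k x by apply: gk; rewrite sk.
    rewrite /t (bigD1 (Ordinal kn))//= mulrDr.
    have : 0 <= \sum_(i < n | i != Ordinal kn) g i x.
      by apply: sumr_ge0 => i _; have [_ g0 _ _] := gP i; exact: g0.
    by move: (\sum_(i < n | _) _) => r r0; lra.
  exists 0%N => // n _; suff -> : h n x = ind U x by rewrite subrr normc0.
  rewrite /h /ind indicE memNset//.
  rewrite /t big1 ?mulr0; last by move=> k _; have [_ _ g0 _] := gP k; exact: g0.
  by rewrite /phi addr0 subr0 normr1 subrr mul0r.
Qed.

(** Open sets are stable under intersection and generate the Borel sets, so only complements and
    countable disjoint unions remain. For the latter, the partial sums of indicators are indicators,
    and they are eventually constant at each point. *)
Let measurable_approx E : measurable (E : set (borel A)) ->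
  continuous_approx (ind E).
Proof.
move=> mE; apply: (@dynkin_induction _ (borel A) (@open A)
  (fun E => continuous_approx (ind E)) _ _ _ _ _ _ E) => //.
- by move=> U V oU oV; exact: openI.
- exact: (open_approx openT).
- move=> B mB hB.
  have -> : ind (~` B) = fun x => 1 + (-1) * ind B x.
    apply/funext => x; rewrite /ind !indicE in_setC.
    by case: (x \in B); rewrite /= ?mulr1 ?mulr0 ?addrN ?addr0.
  apply: continuous_approxD; last exact: continuous_approxZ.
  exact: (continuous_approx_cont (@continuous_cst R A 1)).
move=> F mF tF hF.
have mU : measurable (\bigcup_k F k : set (borel A)) by exact: bigcupT_measurable.
pose g n x := \sum_(0 <= k < n) ind (F k) x.
have gE n x : g n x = ind (\bigcup_(k < n) F k) x.
  elim: n => [|n ih].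
    by rewrite /g big_nil bigcup_mkord big_ord0 /ind indicE in_set0.
  rewrite /g big_nat_recr//= -/(g n x) ih /ind !indicE.
  have -> : \bigcup_(k < n.+1) F k = \bigcup_(k < n) F k `|` F n.
    by rewrite !bigcup_mkord big_ord_recr.
  rewrite in_setU.
  rewrite -(rmorphD (real_complex R)) /=; congr (_%:C)%C.
  case: (boolP (x \in F n)) => xF; last by rewrite orbF addr0.
  rewrite memNset ?add0r ?orbT// => -[k /= kn Fk]; move: xF; rewrite inE => xF.
  by have := tF k n I I (ex_intro _ x (conj Fk xF)); move=> e; rewrite e ltnn in kn.
apply: (@continuous_approx_dominated _ g (fun=> 4)).
- exact: (L2_ind mU).
- by move=> n; apply: continuous_approx_sum.
- exact: integrable_cst.
- by move=> n x; rewrite gE; apply: sqr_normcB_le4; exact: ind_bound.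
- move=> x; apply: cvg_near_cst; have [[k _ Fx]|nF] := pselect ((\bigcup_k F k) x).
    exists k.+1 => // n kn; rewrite /= in kn; rewrite gE.
    suff -> : ind (\bigcup_(k < n) F k) x = ind (\bigcup_k F k) x.
      by rewrite subrr normc0.
    by rewrite /ind !indicE !mem_set//; exists k.
  exists 0%N => // n _; rewrite gE.
  suff -> : ind (\bigcup_(k < n) F k) x = ind (\bigcup_k F k) x.
    by rewrite subrr normc0.
  rewrite /ind !indicE !memNset//.
  by move=> [k _ Fx]; apply: nF; exists k.
Qed.

(** The simple approximations lie between 0 and [f], so [f ^+ 2] dominates the squared errors. *)
Let nonneg_approx (f : A -> R) : measurable_fun [set: borel A] f ->
  mu.-integrable setT (fun x : borel A => (f x ^+ 2)%:E) -> (forall x, 0 <= f x) ->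
  continuous_approx (fun x => (f x)%:C%C).
Proof.
move=> mf If f0.
have cf : @cmeasurable R _ (borel A) (fun x => (f x)%:C%C).
  by split => //=; exact: measurable_cst.
have hf : L2 mu (fun x => (f x)%:C%C).
  split => //; rewrite (_ : (fun x => _) = (fun x => (f x ^+ 2)%:E))//.
  by apply/funext => x; rewrite normc_real real_normK ?num_real.
have mF : measurable_fun [set: borel A] (EFin \o f) by exact/measurable_EFinP.
pose g n := nnsfun_approx measurableT mF n.
have F0 x : [set: borel A] x -> (0 <= (EFin \o f) x)%E.
  by move=> _; rewrite /= lee_fin.
pose gC (n : nat) (x : A) : R[i] := (g n x)%:C%C.
apply: (@continuous_approx_dominated _ gC (fun x => f x ^+ 2) hf _ If).
- move=> n; rewrite /gC.
  rewrite (_ : (fun x => _) = (fun x => \sum_(y <- finmap.enum_fset (fset_set (range (g n))))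
    y%:C%C * ind (g n @^-1` [set y]) x)).
    apply: continuous_approx_sum => y; apply: continuous_approxZ.
    apply: measurable_approx; exact: measurable_sfunP.
  apply/funext => x; rewrite [in LHS]fimfunE fsbig_finite//=.
  by rewrite (rmorph_sum (real_complex R)); apply: eq_bigr => y _; rewrite (rmorphM (real_complex R)).
- move=> n x; rewrite /gC -(rmorphB (real_complex R)) normc_real real_normK ?num_real//.
  have h1 : g n x <= f x.
    by have := @le_approx _ (borel A) R setT (EFin \o f) n x F0 I; rewrite -(nnsfun_approxE measurableT mF) lee_fin.
  have h2 : 0 <= g n x by [].
  by move: (g n x) (f x) h1 h2 => r1 r2; nra.
- move=> x; have := @cvg_nnsfun_approx _ (borel A) R setT measurableT _ mF F0 x I.
  move=> /fine_cvg h.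
  have h' : (g n x - f x) @[n --> \oo] --> (0 : R).
    by rewrite -(subrr (f x)); apply: cvgB; [exact: h|exact: cvg_cst].
  have e : (fun n => normc (gC n x - (f x)%:C%C)) = (fun n => `|g n x - f x|).
    by apply/funext => n; rewrite /gC -(rmorphB (real_complex R)) [LHS]normc_real.
  by rewrite e -(normr0 R); exact: cvg_norm h'.
Qed.

Lemma continuous_dense_L2 f : L2 mu f -> continuous_approx f.
Proof.
move=> [[mr mi] If].
have sq (p : A -> R) : measurable_fun [set: borel A] p ->
    (forall x, p x ^+ 2 <= normc (f x) ^+ 2) -> continuous_approx (fun x => (p x)%:C%C).
  move=> mp pf.
  have part (q : A -> R) : measurable_fun [set: borel A] q -> (forall x, 0 <= q x) ->
      (forall x, q x <= `|p x|) -> continuous_approx (fun x => (q x)%:C%C).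
    move=> mq q0 qp; apply: nonneg_approx => //.
    apply: (le_integrable measurableT _ _ If).
      by apply/measurable_EFinP; exact: measurable_funX.
    move=> x _; rewrite /= lee_fin !ger0_norm ?sqr_ge0//.
    apply: le_trans (pf x); rewrite -[leRHS]real_normK ?num_real//.
    by rewrite lerXn2r ?nnegrE.
  have mn : measurable_fun [set: borel A] (fun x => `|p x|) by exact: measurableT_comp.
  have -> : (fun x => (p x)%:C%C) = (fun x => ((`|p x| + p x) / 2)%:C%C +
      (-1) * ((`|p x| - p x) / 2)%:C%C).
    apply/funext => x; rewrite mulN1r -(rmorphB (real_complex R)).
    by congr (_%:C)%C; field.
  apply: continuous_approxD; last apply: continuous_approxZ.
    apply: part => [|x|x].
    - by apply: measurable_funM; [exact: measurable_funD|exact: measurable_cst].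
    - by have := ler_norm (- p x); rewrite normrN => h; rewrite divr_ge0//; lra.
    - by have := ler_norm (p x); rewrite ler_pdivrMr//; lra.
  apply: part => [|x|x].
  - by apply: measurable_funM; [exact: measurable_funB|exact: measurable_cst].
  - by have := ler_norm (p x) => h; rewrite divr_ge0//; lra.
  - by have := ler_norm (- p x); rewrite normrN ler_pdivrMr//; lra.
have -> : f = fun x => (complex.Re (f x))%:C%C + 'i%C * (complex.Im (f x))%:C%C.
  by apply/funext => x; exact: complexE.
apply: continuous_approxD; last apply: continuous_approxZ.
  by apply: sq => // x; rewrite sqr_normcE lerDl sqr_ge0.
by apply: sq => // x; rewrite sqr_normcE lerDr sqr_ge0.
Qed.

End density.

(** * Parseval for square integrable functions *)

Section parseval_L2.
Context {R : realType} {A : topologicalZmodType}.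
Variable mu : probability (borel A) R.
Hypotheses (hA : compact_abelian_group A) (hmu : haar mu).

Lemma parseval (f : A -> R[i]) (e : R) : L2 mu f -> 0 < e ->
  exists2 F : seq (dual_group R A), uniq F &
    nn mu f <= \sum_(chi <- F) normc (fourier mu f chi) ^+ 2 + e.
Proof.
move=> hf e0; pose d := Num.sqrt e / 2.
have d0 : 0 < d by rewrite divr_gt0// sqrtr_gt0.
have [_ /(_ _ d0)[h ch fh]] := continuous_dense_L2 hA hf.
have hh := continuous_L2 mu hA ch.
have [F uF hF] := continuous_parseval hA hmu ch (exprn_gt0 2 d0).
exists F => //; rewrite -lerBlDl.
rewrite -[leLHS](nn_sub_projection hA hmu uF hf).
pose p := trigpoly F (ip mu h); have hp := L2_trigpoly mu hA F (ip mu h).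
apply: (@le_trans _ _ (nn mu (fun x => f x - p x))).
  (* The projection of [f] is its best approximation with frequencies in [F]: using the coefficients
     of [h] instead adds the sum of the squared coefficient differences. *)
  rewrite (nn_sub_projection hA hmu uF hf) (nn_sub_trigpoly hA hmu _ uF hf).
  rewrite -addrA lerD2l -subr_ge0 opprK Re_sum mulr_sumr -sumrB -big_split.
  apply: sumr_ge0 => chi _; have := sqr_ge0 (normc (ip mu h chi - ip mu f chi)).
  by rewrite sqr_normcB addrAC.
have hp2 : nn mu (fun x => h x - p x) <= d ^+ 2.
  by rewrite (nn_sub_projection hA hmu uF hh) lerBlDl.
have hp1 : nrm mu (fun x => h x - p x) <= d.
  exact: nrm_le (ltW d0) hp2.
have := minkowski (L2B hf hh) (L2B hh hp).
under [X in nrm mu X <= _]eq_fun do rewrite addrA subrK.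
move=> fp; have {}fp : nrm mu (fun x => f x - p x) <= Num.sqrt e.
  by apply: (le_trans fp); rewrite (splitr (Num.sqrt e)) lerD.
rewrite -sqr_nrm -[leRHS](sqr_sqrtr (ltW e0)).
by rewrite lerXn2r ?nnegrE ?nrm_ge0// sqrtr_ge0.
Qed.

End parseval_L2.

(** * Weierstrass approximation on a disc *)

Section bernstein.
Context {T : comNzRingType}.

(* The expectation of [phi] under the binomial law of parameters [n] and [u],
   that is, the [n]-th Bernstein polynomial of [phi]. *)
Fixpoint bernstein (u : T) (n : nat) (phi : nat -> T) : T :=
  if n is m.+1 then
    u * bernstein u m (fun k => phi k.+1) + (1 - u) * bernstein u m phi
  else phi 0%N.

Lemma eq_bernstein (u : T) n phi psi : phi =1 psi ->
  bernstein u n phi = bernstein u n psi.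
Proof.
elim: n phi psi => [|n ih] phi psi e /=; first exact: e.
by rewrite (ih phi psi e) (ih _ (fun k => psi k.+1))// => k.
Qed.

Lemma bernsteinD (u : T) n phi psi :
  bernstein u n (fun k => phi k + psi k) = bernstein u n phi + bernstein u n psi.
Proof. by elim: n phi psi => [//|n ih] phi psi /=; rewrite !ih; ring. Qed.

Lemma bernsteinZ (u : T) n (c : T) phi :
  bernstein u n (fun k => c * phi k) = c * bernstein u n phi.
Proof. by elim: n phi => [//|n ih] phi /=; rewrite !ih; ring. Qed.

Lemma bernstein_cst (u : T) n (c : T) : bernstein u n (fun=> c) = c.
Proof. by elim: n => [//|n ih] /=; rewrite ih; ring. Qed.

(** Second moment of the binomial law about [c]: the variance plus the squared bias. *)
Lemma bernstein_sqr (u : T) n (c : T) :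
  bernstein u n (fun k => (k%:R - c) ^+ 2) =
  n%:R * u * (1 - u) + (n%:R * u - c) ^+ 2.
Proof.
elim: n c => [|n ih] c /=; first by ring.
rewrite ih (@eq_bernstein _ _ _ (fun k => (k%:R - (c - 1)) ^+ 2)); last first.
  by move=> k; rewrite -natr1; congr (_ ^+ 2); ring.
by rewrite ih -natr1; ring.
Qed.

End bernstein.

Lemma rmorph_bernstein (T U : comNzRingType) (f : {rmorphism T -> U}) (u : T) n phi :
  f (bernstein u n phi) = bernstein (f u) n (fun k => f (phi k)).
Proof.
by elim: n phi => [//|n ih] phi /=; rewrite rmorphD !rmorphM rmorphB rmorph1 !ih.
Qed.

Lemma le_bernstein (R : realDomainType) (u : R) n phi psi : 0 <= u <= 1 ->
  (forall k, phi k <= psi k) -> bernstein u n phi <= bernstein u n psi.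
Proof.
move=> /andP[u0 u1]; elim: n phi psi => [|n ih] phi psi h /=; first exact: h.
by rewrite lerD// ler_wpM2l ?subr_ge0//; apply: ih => k.
Qed.

Lemma norm_bernstein (R : realDomainType) (u : R) n phi psi : 0 <= u <= 1 ->
  (forall k, `|phi k| <= psi k) -> `|bernstein u n phi| <= bernstein u n psi.
Proof.
move=> u01 h; rewrite ler_norml; apply/andP; split.
  rewrite -mulN1r -bernsteinZ; apply: le_bernstein => // k.
  by rewrite mulN1r; have := h k; rewrite ler_norml => /andP[].
by apply: le_bernstein => // k; exact: le_trans (ler_norm _) (h k).
Qed.

(** * Polynomials in z and its conjugate *)

Section polynomial_approximation.
Context {R : realType}.
Implicit Types (g : R[i] -> R) (P Q : R[i] -> R[i]).

Inductive zpoly : (R[i] -> R[i]) -> Prop :=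
| zpoly_cst c : zpoly (fun=> c)
| zpoly_id : zpoly id
| zpoly_conj : zpoly (fun z => z^*%C)
| zpolyD P Q : zpoly P -> zpoly Q -> zpoly (fun z => P z + Q z)
| zpolyM P Q : zpoly P -> zpoly Q -> zpoly (fun z => P z * Q z).

Lemma zpoly_bernstein (u : R[i] -> R[i]) n (phi : nat -> R[i] -> R[i]) :
  zpoly u -> (forall k, zpoly (phi k)) ->
  zpoly (fun z => bernstein (u z) n (fun k => phi k z)).
Proof.
move=> zu; elim: n phi => [|n ih] phi zphi /=; first exact: zphi.
apply: zpolyD; apply: zpolyM => //; [exact: (ih (fun k => phi k.+1))| |exact: ih].
rewrite (_ : (fun z => 1 - u z) = (fun z => 1 + (-1) * u z)).
  apply: zpolyD; first exact: zpoly_cst.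
  by apply: zpolyM => //; exact: zpoly_cst.
by apply/funext => z; rewrite mulN1r.
Qed.

(** Uniform continuity settles [|z - w| < d]; beyond, the trivial bound [2 M] is at most [2 M / d^2]
    times the squared distance. Only [z] is confined to the disc. Squared distances are what
    variances and L2 norms can absorb. *)
Lemma continuous_quadratic_modulus g (M C e : R) : continuous g ->
  (forall z, `|g z| <= M) -> 0 < e ->
  exists2 K : R, 0 <= K & forall z w, normc z <= C ->
    `|g z - g w| <= e + K * normc (z - w) ^+ 2.
Proof.
move=> cg gM e0; have M0 : 0 <= M := le_trans (normr_ge0 _) (gM 0).
have /compact_near_coveringP cC := @compact_disc R C.
pose P (d : R) (z : R[i]) := forall w, normc (z - w) < d -> `|g z - g w| < e.
have [d [d0 Pd]] : exists d, 0 < d /\ [set z : R[i] | normc z <= C] `<=` P d.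
  have e2 : 0 < e / 2 by rewrite divr_gt0.
  have h z : [set z : R[i] | normc z <= C] z ->
      \forall z' \near z & d \near 0^'+, P d z'.
    move=> _; have /cvgrPdist_lt /(_ _ e2) /nbhs_normcP[r r0 hr] := cg z.
    exists ([set z' | normc (z - z') < r / 2], [set d | d < r / 2]).
      split; last by apply: nbhs_right_lt; rewrite divr_gt0.
      by apply/nbhs_normcP; exists (r / 2); rewrite ?divr_gt0.
    move=> [z' d] [/= h1 h2] w h3.
    have h4 := hr z' _; have h5 := hr w _.
    rewrite (_ : g z' - g w = (g z - g w) - (g z - g z')); last by ring.
    rewrite (le_lt_trans (ler_normB _ _))// (splitr e) ltrD//.
      apply: h5; have -> : z - w = (z - z') + (z' - w) by ring.
      by rewrite (le_lt_trans (normc_triangle _ _))// (splitr r) ltrD// (lt_trans h3).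
    by apply: h4; rewrite (lt_trans h1)// ltr_pdivrMr// ltr_pMr// ltr1n.
  have H := cC R (0^'+) P (at_right_proper_filter (0 : R)) h.
  have [d [? ?]] := filter_ex (filterI (nbhs_right_gt (0 : R)) H).
  by exists d.
exists (2 * M / d ^+ 2) => [|z w zC]; first by rewrite divr_ge0 ?sqr_ge0// mulr_ge0.
have k0 : 0 <= 2 * M / d ^+ 2 * normc (z - w) ^+ 2.
  by rewrite mulr_ge0 ?sqr_ge0// divr_ge0 ?sqr_ge0// mulr_ge0.
have [lt|ge] := ltP (normc (z - w)) d.
  by rewrite (le_trans (ltW (Pd z zC w lt)))// lerDl.
apply: (@le_trans _ _ (2 * M)).
  by rewrite (le_trans (ler_normB _ _))//; have := gM z; have := gM w; lra.
have : 2 * M <= 2 * M / d ^+ 2 * normc (z - w) ^+ 2.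
  rewrite mulrAC ler_pdivlMr ?exprn_gt0// ler_wpM2l ?mulr_ge0//.
  by rewrite lerXn2r// nnegrE ?normc_ge0// ltW.
by move=> /le_trans; apply; rewrite lerDr ltW.
Qed.

(** A product of two Bernstein operators on the square of side [2 C]. The quadratic modulus reduces
    the error to the two binomial variances. *)
Lemma zpoly_dense g (M C e : R) : continuous g -> (forall z, `|g z| <= M) ->
  0 < C -> 0 < e ->
  exists2 Q, zpoly Q & forall z, normc z <= C -> normc ((g z)%:C%C - Q z) <= e.
Proof.
move=> cg gM C0 e0; have e2 : 0 < e / 2 by rewrite divr_gt0.
have [K K0 hK] := continuous_quadratic_modulus C cg gM e2.
pose D := 2 * C; have D0 : 0 < D by rewrite mulr_gt0.
(* Each binomial variance contributes [a * N * t * (1 - t)], at most a quarter of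
   [K * D ^+ 2 / N]. *)
have [n hn] : exists n : nat, K * D ^+ 2 / n.+1%:R <= e.
  exists (Num.truncn (K * D ^+ 2 / e)); rewrite ler_pdivrMr// [e * _]mulrC.
  rewrite -ler_pdivrMr//; exact/ltW/truncnS_gt.
set N : R := n.+1%:R in hn; have N0 : 0 < N by rewrite /N ltr0n.
(* Nodes may leave the disc, and even the square for indices beyond [N]; this is harmless because
   the second argument of the quadratic modulus is unrestricted. *)
pose node (j k : nat) : R[i] := ((D * (j%:R / N) - C) +i* (D * (k%:R / N) - C))%C.
pose re z := ((complex.Re z + C) / D) : R; pose im z := ((complex.Im z + C) / D) : R.
pose Q z := bernstein ((re z)%:C%C) n.+1 (fun j => bernstein ((im z)%:C%C) n.+1
  (fun k => (g (node j k))%:C%C)).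
have zre : zpoly (fun z => (re z)%:C%C).
  rewrite (_ : (fun z => _) = (fun z => (2^-1 / D)%:C%C * (z + z^*%C) + (C / D)%:C%C)).
    apply: zpolyD; last exact: zpoly_cst.
    by apply: zpolyM; [exact: zpoly_cst|apply: zpolyD; [exact: zpoly_id|exact: zpoly_conj]].
  apply/funext => -[a b]; rewrite /re; congr Complex => /=; field; exact: lt0r_neq0.
have zim : zpoly (fun z => (im z)%:C%C).
  rewrite (_ : (fun z => _) = (fun z => (0 +i* (- (2^-1 / D)))%C * (z + (-1) * z^*%C) +
      (C / D)%:C%C)).
    apply: zpolyD; last exact: zpoly_cst.
    apply: zpolyM; first exact: zpoly_cst.
    apply: zpolyD; first exact: zpoly_id.
    by apply: zpolyM; [exact: zpoly_cst|exact: zpoly_conj].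
  apply/funext => -[a b]; rewrite /im; congr Complex => /=; field; exact: lt0r_neq0.
exists Q.
  apply: zpoly_bernstein => // j; apply: zpoly_bernstein => // k; exact: zpoly_cst.
move=> z zC.
have u01 (x : R) : `|x| <= C -> 0 <= (x + C) / D <= 1.
  rewrite ler_norml => /andP[h1 h2]; apply/andP; split.
    by apply: divr_ge0; [lra|exact: ltW].
  by rewrite ler_pdivrMr// /D; lra.
have ru : 0 <= re z <= 1 by apply: u01; exact: le_trans (ler_Re_normc z) zC.
have iu : 0 <= im z <= 1 by apply: u01; exact: le_trans (ler_Im_normc z) zC.
have -> : Q z = (bernstein (re z) n.+1 (fun j => bernstein (im z) n.+1
    (fun k => g (node j k))))%:C%C.
  rewrite (rmorph_bernstein (real_complex R)); apply: eq_bernstein => j.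
  by rewrite [RHS](rmorph_bernstein (real_complex R)).
rewrite -(rmorphB (real_complex R)) normc_real distrC.
have -> : bernstein (re z) n.+1 (fun j => bernstein (im z) n.+1
    (fun k => g (node j k))) - g z =
  bernstein (re z) n.+1 (fun j => bernstein (im z) n.+1
    (fun k => g (node j k) + (- g z))).
  rewrite -[in LHS](bernstein_cst (re z) n.+1 (- g z)) -bernsteinD.
  apply: eq_bernstein => j; rewrite bernsteinD; congr (_ + _).
  by rewrite bernstein_cst.
(* [K] times the square of the mesh [D / N], which converts distances between points into distances
   between indices. *)
pose a := K * D ^+ 2 / N ^+ 2.
have dist j k : `|g (node j k) + (- g z)| <=
    (e / 2 + a * (j%:R - N * re z) ^+ 2) + a * (k%:R - N * im z) ^+ 2.
  rewrite distrC (le_trans (hK z (node j k) zC))// -addrA lerD2l.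
  rewrite sqr_normcE /node /a /re /im; case: (z) => x y /=.
  rewrite le_eqVlt; apply/orP; left; apply/eqP; field.
  by rewrite !lt0r_neq0.
apply: (@le_trans _ _ (bernstein (re z) n.+1 (fun j => bernstein (im z) n.+1
    (fun k => (e / 2 + a * (j%:R - N * re z) ^+ 2) + a * (k%:R - N * im z) ^+ 2)))).
  by apply: norm_bernstein => // j; apply: norm_bernstein.
under eq_bernstein do rewrite bernsteinD bernstein_cst bernsteinZ bernstein_sqr.
rewrite bernsteinD bernsteinD !bernstein_cst bernsteinZ bernstein_sqr -/N.
rewrite !subrr expr0n /= !addr0.
have a0 : 0 <= a by rewrite divr_ge0 ?sqr_ge0// mulr_ge0 ?sqr_ge0.
have aN : a * N <= e.
  by rewrite /a (_ : _ * N = K * D ^+ 2 / N)//; field; exact: lt0r_neq0.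
have q (t : R) : 0 <= t <= 1 -> a * (N * t * (1 - t)) <= e / 4.
  move=> /andP[t0 t1]; rewrite (_ : a * _ = a * N * (t * (1 - t))); last by ring.
  have t4 : t * (1 - t) <= 4^-1.
    by have := sqr_ge0 (t - 2^-1); rewrite sqrrB; lra.
  have t5 : 0 <= t * (1 - t) by rewrite mulr_ge0// subr_ge0.
  have : 0 <= a * N by rewrite mulr_ge0// ltW.
  by move: (a * N) (t * (1 - t)) aN t4 t5 => r1 r2; nra.
have := q _ ru; have := q _ iu; lra.
Qed.

End polynomial_approximation.

(** * Integrals of words in characters *)

Section words.
Context {R : realType} {I : eqType}.
Implicit Types (w : seq (I * bool)) (s : seq (R[i] * seq (I * bool))).

(* A letter [(i, true)] stands for the [i]-th character and [(i, false)] for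
   its conjugate. *)
Definition eval_word (T : Type) (psi : I -> T -> R[i]) w (x : T) : R[i] :=
  \prod_(l <- w) (if l.2 then psi l.1 x else (psi l.1 x)^*%C).

Definition eval_expr (T : Type) (psi : I -> T -> R[i]) s (x : T) : R[i] :=
  \sum_(t <- s) t.1 * eval_word psi t.2 x.

Definition word_in (F : seq I) w := all (fun l => l.1 \in F) w.

(** The expression [s] is chosen before the space and the family [psi]: the same formal sum of words
    serves on both groups. *)
Lemma zpoly_expand (F : seq I) (b : I -> R[i]) (Q : R[i] -> R[i]) : zpoly Q ->
  exists2 s, all (fun t => word_in F t.2) s &
    forall (T : Type) (psi : I -> T -> R[i]) x,
      Q (\sum_(i <- F) b i * psi i x) = eval_expr psi s x.
Proof.
elim=> [c| | |P1 P2 _ [s1 a1 e1] _ [s2 a2 e2]|P1 P2 _ [s1 a1 e1] _ [s2 a2 e2]].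
- exists [:: (c, [::])] => // T psi x.
  by rewrite /eval_expr big_seq1 /eval_word /= big_nil mulr1.
- exists [seq (b i, [:: (i, true)]) | i <- F].
    by apply/allP => _ /mapP[i iF ->] /=; rewrite /word_in /= iF.
  move=> T psi x; rewrite /eval_expr big_map; apply: eq_bigr => i _.
  by rewrite /eval_word big_seq1.
- exists [seq ((b i)^*%C, [:: (i, false)]) | i <- F].
    by apply/allP => _ /mapP[i iF ->] /=; rewrite /word_in /= iF.
  move=> T psi x; rewrite conjc_sum /eval_expr big_map; apply: eq_bigr => i _.
  by rewrite /eval_word big_seq1 conjcM.
- exists (s1 ++ s2); first by rewrite all_cat a1.
  by move=> T psi x; rewrite e1 e2 /eval_expr big_cat.
- exists [seq (t1.1 * t2.1, t1.2 ++ t2.2) | t1 <- s1, t2 <- s2].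
    apply/allP => _ /allpairsP[[t1 t2] [/= h1 h2 ->]] /=.
    by rewrite /word_in all_cat; apply/andP; split; [exact: (allP a1)|exact: (allP a2)].
  move=> T psi x; rewrite e1 e2 /eval_expr big_allpairs_dep mulr_suml.
  apply: eq_bigr => t1 _; rewrite mulr_sumr; apply: eq_bigr => t2 _ /=.
  by rewrite /eval_word big_cat /= mulrACA.
Qed.

Definition sign_of (c : bool) : int := if c then 1 else -1.

Definition word_prod (G : groupType) (psi : I -> G) w : G :=
  (\prod_(l <- w) gexpz (psi l.1) (sign_of l.2))%g.

(** A partial isomorphism of weight [n] tests products of exactly [n] factors; shorter words are
    completed with exponent 0. *)
Lemma word_prod_pad (G : groupType) (psi : I -> G) (l0 : I * bool) w n :
  (size w <= n)%N ->
  (\prod_(i < n) gexpz (psi (nth l0 w i).1)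
     (if (i < size w)%N then sign_of (nth l0 w i).2 else 0))%g = word_prod psi w.
Proof.
move=> wn; rewrite /word_prod (big_nth l0).
pose H i := gexpz (psi (nth l0 w i).1)
  (if (i < size w)%N then sign_of (nth l0 w i).2 else 0).
rewrite -(big_mkord xpredT H) (big_cat_nat _ wn)//=.
rewrite [X in (_ * X)%g]big_nat_cond [X in (_ * X)%g]big1; last first.
  by move=> i /andP[/andP[wi _] _]; rewrite /H ltnNge wi /= expg0.
rewrite mulg1 !big_nat; apply: eq_bigr => i /andP[_ iw].
by rewrite /H iw.
Qed.

Lemma partial_isomorphism_word (G1 G2 : groupType) n (S1 : set G1) (S2 : set G2)
    (phi : G1 -> G2) (F : seq I) (psi : I -> G1) (chi : I -> G2) w :
  partial_isomorphism n S1 S2 phi ->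
  {in F, forall i, S1 (psi i) /\ phi (psi i) = chi i} ->
  word_in F w -> (size w <= n)%N ->
  word_prod psi w = 1%g <-> word_prod chi w = 1%g.
Proof.
(* The padding repeats a letter of the word, so that its character lies in [S1]; the empty word has
   none to offer and is treated apart. *)
move=> [_ iso] hF; case: w => [|l0 w'] wF wn.
  by rewrite /word_prod !big_nil.
set w := l0 :: w' in wF wn *.
have inF (i : 'I_n) : (nth l0 w i).1 \in F.
  have [iw|iw] := ltnP i (size w); first exact: (allP wF _ (mem_nth l0 iw)).
  by rewrite nth_default//; apply: (allP wF); rewrite mem_head.
have := iso (fun i => psi (nth l0 w i).1)
  (fun i => if (i < size w)%N then sign_of (nth l0 w i).2 else 0).
rewrite (word_prod_pad psi l0 wn).
have -> : (\prod_(i < n) gexpz (phi (psi (nth l0 w i).1))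
   (if (i < size w)%N then sign_of (nth l0 w i).2 else 0))%g = word_prod chi w.
  rewrite -(word_prod_pad chi l0 wn); apply: eq_bigr => i _.
  by have [_ ->] := hF _ (inF i).
apply=> i; first by have [] := hF _ (inF i).
by case: ifP => _; rewrite !inE ?eqxx ?orbT//; case: (nth l0 w i).2.
Qed.

End words.

(** * Integrals of expressions in characters *)

Section word_integral.
Context {R : realType} {A : topologicalZmodType}.
Variable mu : probability (borel A) R.
Hypotheses (hA : compact_abelian_group A) (hmu : haar mu).
Context {I : eqType}.
Implicit Types (psi : I -> dual_group R A) (w : seq (I * bool)).

(** On the unit circle conjugation is inversion, so a word evaluates to a single character. *)
Lemma eval_wordE psi w x :
  eval_word (fun i => psi i : A -> R[i]) w x = word_prod psi w x.
Proof.
rewrite /eval_word /word_prod; elim: w => [|l w ih].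
  by rewrite !big_nil.
rewrite !big_cons ih; case: l => i [] /=.
  by [].
congr (_ * _); have h := mulJ_character (psi i) x.
have n0 : psi i x != 0.
  by apply/eqP => e; move/eqP : h; rewrite e mul0r eq_sym oner_eq0.
by apply: (mulfI n0); rewrite h divff.
Qed.

Lemma integral_word psi w :
  cintegral mu (eval_word (fun i => psi i : A -> R[i]) w) =
  (word_prod psi w == 1%g)%:R.
Proof.
rewrite -(ip_character hA hmu); apply: eq_cintegral => x.
by rewrite eval_wordE [X in _ * X](@conjc1 R) mulr1.
Qed.

Lemma cintegrable_word psi w :
  cintegrable mu (eval_word (fun i => psi i : A -> R[i]) w).
Proof.
rewrite (_ : eval_word _ _ = word_prod psi w); last by apply/funext => x; exact: eval_wordE.
exact: (continuous_cintegrable mu hA (continuous_character (chi := word_prod psi w))).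
Qed.

Lemma integral_expr psi s :
  cintegral mu (eval_expr (fun i => psi i : A -> R[i]) s) =
  \sum_(t <- s) t.1 * (word_prod psi t.2 == 1%g)%:R.
Proof.
rewrite /eval_expr cintegral_sum.
  apply: eq_bigr => t _; rewrite cintegralZ; last exact: cintegrable_word.
  by rewrite integral_word.
by move=> t; apply: cintegrableZ; exact: cintegrable_word.
Qed.

End word_integral.

(** * Square integrability and quadratic comparison of integrals *)

Lemma L2normP (R : realType) (d : measure_display) (T : measurableType d)
    (mu : probability T R) (f : T -> R[i]) :
  cmeasurable f -> (L2norm mu f < +oo)%E ->
  L2 mu f /\ L2norm mu f = (nrm mu f)%:E.
Proof.
move=> mf; rewrite /L2norm; set N := 'N[mu]_2%:E[_]%E => Noo.
have N0 : (0 <= N)%E by exact: Lnorm_ge0.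
have E : (N `^ 2 = \int[mu]_x (normc (f x) ^+ 2)%:E)%E.
  rewrite /N poweR_Lnorm//; apply: eq_integral => x _.
  by rewrite /= ger0_norm ?normc_ge0// powR_mulrn ?normc_ge0.
case: N Noo N0 E => [r| |]// _ r0 E; rewrite lee_fin in r0.
have {}E : (\int[mu]_x (normc (f x) ^+ 2)%:E = (r ^+ 2)%:E)%E.
  by rewrite -E poweR_EFin powR_mulrn.
split.
  split => //; apply/integrableP; split.
    by apply/measurable_EFinP; exact: cmeasurable_normc_sqr.
  under eq_integral do rewrite gee0_abs ?lee_fin ?sqr_ge0//.
  by rewrite E ltry.
congr EFin; rewrite /nrm /nn /Rintegral E /= sqrtr_sqr ger0_norm//.
Qed.

Section comparison.
Context {R : realType} {d : measure_display} {T : measurableType d}.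
Variable mu : probability T R.

(** The term with [K] integrates to the squared L2 distance; the term with [c] pays for the large
    values of [f], where no uniform modulus of [g] is available. *)
Lemma integral_quadratic_close (g : R[i] -> R) (f p : T -> R[i]) (M K c e : R) :
  L2 mu f -> L2 mu p ->
  measurable_fun setT (g \o f) -> measurable_fun setT (g \o p) ->
  (forall z, `|g z| <= M) ->
  (forall z w, `|g z - g w| <= e + K * normc (z - w) ^+ 2 + c * normc z ^+ 2) ->
  `|\int[mu]_x g (f x) - \int[mu]_x g (p x)| <=
    e + K * nn mu (fun x => f x - p x) + c * nn mu f.
Proof.
move=> hf hp mgf mgp gM H.
have If : mu.-integrable setT (EFin \o (g \o f)).
  by apply: (@bounded_integrable _ _ _ _ _ M) => // x; exact: gM.
have Ip : mu.-integrable setT (EFin \o (g \o p)).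
  by apply: (@bounded_integrable _ _ _ _ _ M) => // x; exact: gM.
have Ifp : mu.-integrable setT (EFin \o (fun x => g (f x) - g (p x))).
  exact: (integrableB measurableT If Ip).
have [_ I1] := L2B hf hp; have [_ I2] := hf.
have J1 := integrableZl measurableT K I1; have J2 := integrableZl measurableT c I2.
have J0 : mu.-integrable setT (EFin \o (fun _ : T => e)).
  exact: finite_measure_integrable_cst.
have J01 := integrableD measurableT J0 J1.
have J012 := integrableD measurableT J01 J2.
have Inorm : mu.-integrable setT (EFin \o (fun x => `|g (f x) - g (p x)|)).
  exact: (integrable_norm Ifp).
rewrite -(RintegralB measurableT If Ip).
apply: (le_trans (le_normr_Rintegral measurableT Ifp)).
have -> : e + K * nn mu (fun x => f x - p x) + c * nn mu f =
    \int[mu]_x ((e + K * normc (f x - p x) ^+ 2) + c * normc (f x) ^+ 2).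
  rewrite (RintegralD measurableT J01 J2) (RintegralD measurableT J0 J1).
  rewrite (RintegralZl _ measurableT I1) (RintegralZl _ measurableT I2).
  by rewrite Rintegral_cst//= probability_setT mulr1.
by apply: (le_Rintegral measurableT Inorm J012) => x _; exact: H.
Qed.

Lemma normc_cintegral_le (h : T -> R[i]) (e : R) : cmeasurable h -> 0 <= e ->
  (forall x, normc (h x) <= e) -> normc (cintegral mu h) <= e.
Proof.
move=> mh e0 he; have hh := L2_bounded mu mh he; have h1 := L2_cst mu 1.
have -> : cintegral mu h = ip mu h (fun=> 1).
  by apply: eq_cintegral => x; rewrite conjc1 mulr1.
apply: (le_trans (cauchy_schwarz_nrm hh h1)).
have n1 : nrm mu (fun=> 1) <= 1.
  by apply: le_nrm; [exact: ler01|move=> _; rewrite normc1|exact: cmeasurable_cst].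
have := le_nrm mu e0 he mh; have := nrm_ge0 mu h; have := nrm_ge0 mu (fun=> 1).
by move: (nrm mu h) (nrm mu _) n1 => r1 r2; nra.
Qed.

End comparison.

(** Dropping the frequencies with zero coefficient loses no energy and leaves finitely many
    coefficients bounded away from 0. *)
Lemma sum_sqr_normc_support (R : realType) (I : Type) (b : I -> R[i]) (s : seq I) :
  \sum_(i <- s) normc (b i) ^+ 2 =
  \sum_(i <- [seq i <- s | b i != 0]) normc (b i) ^+ 2.
Proof.
elim: s => [|i s ih]; first by rewrite !big_nil.
rewrite big_cons ih big_filter [RHS]big_filter [RHS]big_cons.
by case: eqVneq => [->|//]; rewrite normc0 expr0n add0r.
Qed.

Lemma positive_lower_bound (R : realType) (s : seq R) :
  all (fun x => 0 < x) s -> exists2 e : R, 0 < e & {in s, forall x, e <= x}.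
Proof.
elim: s => [|x s ih] /=; first by exists 1.
move=> /andP[x0 /ih[e e0 h]]; exists (Num.min x e); first by rewrite lt_min x0.
move=> y; rewrite inE => /orP[/eqP->|/h ey]; first by rewrite ge_min lexx.
by rewrite ge_min ey orbT.
Qed.

Lemma d_tight_lt (R : realType) (A1 A2 : topologicalZmodType)
    (mu1 : probability (borel A1) R) (mu2 : probability (borel A2) R)
    (f1 : A1 -> R[i]) (f2 : A2 -> R[i]) (e : R) :
  (d_tight mu1 mu2 f1 f2 < e%:E)%E ->
  (exists2 eps : R, 0 < eps < e & exists S1 S2 phi,
    eps_isomorphism eps (fourier mu1 f1) (fourier mu2 f2) S1 S2 phi) /\
  (`|L2norm mu1 f1 - L2norm mu2 f2| < e%:E)%E.
Proof.
rewrite /d_tight => h.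
have d0 : (0 <= d_L2 mu1 mu2 f1 f2)%E.
  by apply/ereal_infP => _ [eps [e0 _] <-]; rewrite lee_fin ltW.
split; last by apply: le_lt_trans h; exact: leeDr.
have : (d_L2 mu1 mu2 f1 f2 < e%:E)%E by apply: le_lt_trans h; exact: leeDl.
move=> /ereal_inf_lt[_ [eps [e0 iso] <-]]; rewrite lte_fin => ee.
by exists eps; rewrite ?e0.
Qed.

(** The error budget: two comparisons with trigonometric polynomials at [3 e / 8] each and two
    polynomial approximations at [e / 8] each, around the common value [q]. *)
Lemma four_step_distance (R : realFieldType) (e a b c d q r1 r2 r3 r4 : R) :
  `|a - b| <= e / 8 + r1 + r3 -> `|c - d| <= e / 8 + r2 + r4 ->
  `|b - q| <= e / 8 -> `|d - q| <= e / 8 ->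
  r1 <= e / 8 -> r2 <= e / 8 -> r3 <= e / 8 -> r4 <= e / 8 -> `|c - a| <= e.
Proof.
rewrite !ler_norml => /andP[? ?] /andP[? ?] /andP[? ?] /andP[? ?] ? ? ? ?.
by apply/andP; split; lra.
Qed.

(** * Stability of integrals under tight closeness *)

Section tight.
Context {R : realType} {A : topologicalZmodType}.
Variable mu : probability (borel A) R.
Hypotheses (hA : compact_abelian_group A) (hmu : haar mu).

(** The threshold [e0] depends on [f], [g] and [e] alone; the group [B] is quantified after it, as
    the groups of the sequence vary. *)
Lemma tight_close (f : A -> R[i]) (g : R[i] -> R) (M e : R) :
  measurable_fun [set: borel A] (f : borel A -> borel R[i]) ->
  (L2norm mu f < +oo)%E -> continuous g -> (forall z, `|g z| <= M) -> 0 < e ->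
  exists2 e0 : R, 0 < e0 & forall (B : topologicalZmodType)
    (nu : probability (borel B) R) (h : B -> R[i]),
    compact_abelian_group B -> haar nu ->
    measurable_fun [set: borel B] (h : borel B -> borel R[i]) ->
    (d_tight nu mu h f < e0%:E)%E ->
    `|\int[nu]_x g (h x) - \int[mu]_x g (f x)| <= e.
Proof.
move=> mf fL2 cg gM e_gt0.
have M0 : 0 <= M := le_trans (normr_ge0 _) (gM 0).
have [hf fN] := L2normP (borel_cmeasurable mf) fL2.
have e8 : 0 < e / 8 by rewrite divr_gt0.
(* [B0] will bound the squared norm of every [h] in range. Outside the disc of squared radius [c2],
   [2 M] is at most [c * |z|^2] with [c = 2 M / c2], and [c2] is so large that [c * B0] is at most
   [e / 8]. *)
pose B0 := nn mu f + 1; have B00 : 0 < B0 by rewrite ltr_wpDl// nn_ge0.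
pose c2 := 16 * M * B0 / e + 1.
have e_ge0 := ltW e_gt0; have B0_ge0 := ltW B00.
have c20 : 0 < c2 by rewrite ltr_wpDl// divr_ge0// !mulr_ge0.
have [K K0 hK] := continuous_quadratic_modulus (Num.sqrt c2) cg gM e8.
pose c := 2 * M / c2; have c0 : 0 <= c by rewrite divr_ge0 ?mulr_ge0// ltW.
have cB : c * B0 <= e / 8.
  rewrite /c mulrAC ler_pdivrMr// /c2.
  have -> : e / 8 * (16 * M * B0 / e + 1) = 2 * M * B0 + e / 8.
    by field; exact: lt0r_neq0.
  by rewrite lerDl ltW.
have modg z w : `|g z - g w| <= e / 8 + K * normc (z - w) ^+ 2 + c * normc z ^+ 2.
  have [zC|zC] := lerP (normc z) (Num.sqrt c2).
    by rewrite (le_trans (hK z w zC))// lerDl mulr_ge0// sqr_ge0.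
  have zc : c2 <= normc z ^+ 2.
    rewrite -[leLHS](sqr_sqrtr (ltW c20)) lerXn2r ?nnegrE ?sqrtr_ge0 ?normc_ge0//.
    exact: ltW.
  apply: (@le_trans _ _ (c * normc z ^+ 2)); last first.
    rewrite lerDr; apply: addr_ge0; first exact: ltW.
    by apply: mulr_ge0 => //; exact: sqr_ge0.
  apply: (@le_trans _ _ (2 * M)).
    by rewrite (le_trans (ler_normB _ _))//; have := gM z; have := gM w; lra.
  by rewrite /c mulrAC ler_pdivlMr// ler_wpM2l// mulr_ge0.
(* Both squared distances to the trigonometric polynomials will be at most [2 * dl]. *)
pose dl := e / 16 / (K + 1); have K1 : 0 < K + 1 by rewrite ltr_wpDl.
have dl0 : 0 < dl by rewrite !divr_gt0.
have Kdl : K * (2 * dl) <= e / 8.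
  rewrite /dl (_ : K * _ = e / 8 * (K / (K + 1))); last by field; exact: lt0r_neq0.
  by rewrite ler_piMr ?(ltW e8)// ler_pdivrMr// mul1r lerDl.
have [F0 uF0 F0P] := parseval hA hmu hf dl0.
have [b bE] : exists b, b = fourier mu f by exists (fourier mu f).
pose F := [seq chi <- F0 | b chi != 0]; have uF : uniq F by exact: filter_uniq.
pose s2 := \sum_(chi <- F) normc (b chi) ^+ 2.
pose s1 := \sum_(chi <- F) normc (b chi).
have s10 : 0 <= s1 by apply: sumr_ge0 => chi _; exact: normc_ge0.
have s2P : nn mu f <= s2 + dl.
  by apply: (le_trans F0P); rewrite -bE (sum_sqr_normc_support b).
have s11 : 0 < s1 + 1 by rewrite ltr_wpDl.
have [Q zQ gQ] := zpoly_dense cg gM s11 e8.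
have [s sF sE] := zpoly_expand F b zQ.
pose N := \max_(t <- s) size t.2.
have nf0 := nrm_ge0 mu f.
have n1 : 0 < 2 * nrm mu f + 1 by rewrite ltr_wpDl// mulr_ge0.
(* In order, the entries make the weight cover the longest word, keep the excess of [nn nu h] over
   [nn mu f] below [dl / 2] and below 1, limit the total coefficient error, and ensure that the
   square of [e0] is at most [e0]. The moduli of the coefficients are then added, so that [F] lies
   in the [eps]-support of the transform of [f]. *)
pose cs : seq R := [:: N.+1%:R^-1; dl / 2 / (2 * nrm mu f + 1);
  (2 * nrm mu f + 1)^-1; dl / 4 / (s1 + 1); 1].
have csP : all (fun x => 0 < x) (cs ++ [seq normc (b chi) | chi <- F]).
  rewrite all_cat; apply/andP; split.
    by rewrite /cs /= !invr_gt0 ltr0n n1 !divr_gt0// ltr01.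
  apply/allP => _ /mapP[chi chiF ->]; rewrite lt_neqAle normc_ge0 andbT eq_sym.
  by move: chiF; rewrite mem_filter => /andP[+ _]; apply: contra => /eqP /eq0_normc ->.
have [e0 e00 e0P] := positive_lower_bound csP.
have cs_le x : x \in cs -> e0 <= x by move=> xs; apply: e0P; rewrite mem_cat xs.
have eN : e0 <= N.+1%:R^-1 by apply: cs_le; rewrite !inE eqxx.
have ed : e0 * (2 * nrm mu f + 1) <= dl / 2.
  by rewrite -ler_pdivlMr//; apply: cs_le; rewrite !inE eqxx !orbT.
have e1 : e0 * (2 * nrm mu f + 1) <= 1.
  by rewrite -ler_pdivlMr// div1r; apply: cs_le; rewrite !inE eqxx !orbT.
have es : e0 * (s1 + 1) <= dl / 4.
  by rewrite -ler_pdivlMr//; apply: cs_le; rewrite !inE eqxx !orbT.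
have ele1 : e0 <= 1 by apply: cs_le; rewrite !inE eqxx !orbT.
have eb chi : chi \in F -> e0 <= normc (b chi).
  by move=> cF; apply: e0P; rewrite mem_cat; apply/orP; right; apply/mapP; exists chi.
exists e0 => // B nu h hB hnu mh hclose.
have [[eps /andP[eps0 epse] [S1 [S2 [phi [iso S1P S2P nearP]]]]] hN] := d_tight_lt hclose.
have hL2 : (L2norm nu h < +oo)%E.
  by move: hN; rewrite fN; case: (L2norm nu h) => [r| |]//=; rewrite ltry.
have [hh hhN] := L2normP (borel_cmeasurable mh) hL2.
have nnh : nn nu h <= nn mu f + e0 * (2 * nrm mu f + 1).
  move: hN; rewrite hhN fN -EFinB abse_EFin lte_fin -!sqr_nrm => /ltr_normlW.
  have := nrm_ge0 nu h; move: (nrm nu h) (nrm mu f) nf0 => r1 r2 r20 r10 r12.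
  have h1 : 0 <= (r2 + e0 - r1) * (r2 + e0 + r1).
    by rewrite mulr_ge0//; [lra|rewrite !addr_ge0// ltW].
  have h2 : 0 <= e0 * (1 - e0) by rewrite mulr_ge0 ?subr_ge0// ltW.
  by move: h1 h2; lra.
have wN : (N <= `|Num.ceil eps^-1|)%N.
  have h1 : N.+1%:R <= eps^-1.
    rewrite -[leLHS]invrK lef_pV2 ?posrE ?invr_gt0 ?ltr0n//.
    exact: (le_trans (ltW epse) eN).
  have h2 : (N%:Z <= Num.ceil eps^-1)%R.
    rewrite -(ler_int R) (le_trans _ (ceil_ge _))// (le_trans _ h1)//.
    by rewrite -[leLHS]/(N%:R) ler_nat.
  by rewrite -lez_nat (le_trans h2)// lez_abs.
(* [psi] inverts [phi] on [F]; the trivial character is a default elsewhere. *)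
have /choice[psi psiP] : forall chi : dual_group R A, exists ch : dual_group R B,
    chi \in F -> S1 ch /\ phi ch = chi.
  move=> chi; have [cF|cF] := boolP (chi \in F); last by exists (dual_one R B).
  have [[_ _ surj] _] := iso.
  have Schi : supp eps (fourier mu f) chi.
    by rewrite -bE; exact: (lt_le_trans epse (eb chi cF)).
  by have [ch S1ch echi] := surj chi (S2P chi Schi); exists ch.
pose p := trigpoly F b.
pose p' x := \sum_(chi <- F) b chi * psi chi x.
have psi_inj : {in F &, injective psi}.
  by move=> c1 c3 /psiP[_ h1] /psiP[_ h3] e13; rewrite -h1 -h3 e13.
have p'E : p' = trigpoly (map psi F) (b \o phi).
  apply/funext => x; rewrite /p' /trigpoly big_map; apply: eq_big_seq => chi cF.
  by rewrite /= (proj2 (psiP chi cF)).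
have uF' : uniq (map psi F) by rewrite map_inj_in_uniq.
have cp : continuous p := continuous_trigpoly (F := F) (b := b).
have cp' : continuous p' by rewrite p'E; exact: continuous_trigpoly.
have hp := continuous_L2 mu hA cp; have hp' := continuous_L2 nu hB cp'.
have bound_p x : normc (p x) <= s1.
  rewrite /p /trigpoly /s1; elim: (F) => [|chi F' ih]; first by rewrite !big_nil normc0.
  rewrite !big_cons (le_trans (normc_triangle _ _))// lerD//.
  by rewrite normcM normc_character mulr1.
have bound_p' x : normc (p' x) <= s1.
  rewrite /p' /s1; elim: (F) => [|chi F' ih]; first by rewrite !big_nil normc0.
  rewrite !big_cons (le_trans (normc_triangle _ _))// lerD//.
  by rewrite normcM normc_character mulr1.
have close : nn mu (fun x => f x - p x) <= 2 * dl.
  have -> : nn mu (fun x => f x - p x) = nn mu f - s2.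
    by rewrite /p /s2 bE (nn_sub_projection hA hmu uF hf).
  by move: s2P dl0; lra.
have close' : nn nu (fun x => h x - p' x) <= 2 * dl.
  rewrite p'E (nn_sub_trigpoly hB hnu _ uF' hh) !big_map.
  have -> : \sum_(chi <- F) normc ((b \o phi) (psi chi)) ^+ 2 = s2.
    by apply: eq_big_seq => chi cF; rewrite /= (proj2 (psiP chi cF)).
  rewrite Re_sum.
  (* Replacing the coefficient of [f] by that of [h] at [psi chi] costs at most [e0] times the
     modulus of [b chi]. *)
  have lowb : s2 - e0 * s1 <= \sum_(chi <- F)
      complex.Re (((b \o phi) (psi chi))^*%C * ip nu h (psi chi)).
    rewrite /s2 /s1 mulr_sumr -sumrB big_seq [leRHS]big_seq.
    apply: ler_sum => chi cF; have [S1c phic] := psiP chi cF.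
    have -> : (b \o phi) (psi chi) = b chi by rewrite /= phic.
    have := nearP _ S1c; rewrite phic -bE.
    change (fourier nu h (psi chi)) with (ip nu h (psi chi)).
    move: (ip nu h (psi chi)) (b chi) => z w zw.
    have -> : w^*%C * z = w^*%C * w + w^*%C * (z - w) by ring.
    have ww : complex.Re (w^*%C * w) = normc w ^+ 2 by rewrite mulrC mulcJ.
    rewrite ReD ww lerD2l lerNl.
    have h1 := ler_Re_normc (w^*%C * (z - w)); rewrite normcM normcJ in h1.
    have h2 := ler_norm (- complex.Re (w^*%C * (z - w))); rewrite normrN in h2.
    rewrite (le_trans h2)// (le_trans h1)// mulrC.
    by rewrite ler_wpM2r ?normc_ge0// (le_trans zw)// ltW.
  have : e0 * s1 <= dl / 4 by apply: le_trans es; rewrite ler_wpM2l ?lerDl// ltW.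
  move: lowb nnh ed s2P; move: (nn nu h) (nn mu f) (\sum_(chi <- F) _) => r1 r2 r3.
  by move: (e0 * s1) (e0 * (2 * nrm mu f + 1)) => r4 r5; lra.
have mgf : measurable_fun [set: borel A] (g \o f).
  exact: (measurableT_comp (continuous_borel_measurable cg) mf).
have mgh : measurable_fun [set: borel B] (g \o h).
  exact: (measurableT_comp (continuous_borel_measurable cg) mh).
have cgp : continuous (g \o p).
  by move=> x; apply: continuous_comp; [exact: cp|exact: cg].
have cgp' : continuous (g \o p').
  by move=> x; apply: continuous_comp; [exact: cp'|exact: cg].
have E1 := integral_quadratic_close hf hp mgf (continuous_borel_measurable cgp) gM modg.
have E2 := integral_quadratic_close hh hp' mgh (continuous_borel_measurable cgp') gM modg.
(* Both integrals are the sum of the coefficients of the words with trivial product, and the partial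
   isomorphism preserves triviality. *)
have QE : cintegral nu (Q \o p') = cintegral mu (Q \o p).
  have -> : Q \o p' = eval_expr (fun chi : dual_group R A => psi chi : B -> R[i]) s.
    by apply/funext => x; exact: sE.
  have -> : Q \o p = eval_expr (fun chi : dual_group R A => chi : A -> R[i]) s.
    by apply/funext => x; exact: (sE _ (fun chi : dual_group R A => chi : A -> R[i])).
  rewrite (integral_expr hB hnu) (integral_expr hA hmu (fun chi : dual_group R A => chi)).
  apply: eq_big_seq => t ts; congr (_ * _%:R); congr nat_of_bool.
  have tN : (size t.2 <= `|Num.ceil eps^-1|)%N.
    by apply: leq_trans wN; exact: (@leq_bigmax_seq _ s xpredT (fun t => size t.2) t ts isT).
  have [h1 h2] := partial_isomorphism_word (chi := fun c : dual_group R A => c) iso psiP (allP sF t ts) tN.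
  by apply/eqP/eqP; [exact: h1|exact: h2].
have intQ (C : topologicalZmodType) (la : probability (borel C) R) (q : C -> R[i]) :
    compact_abelian_group C -> continuous q -> continuous (g \o q) ->
    cintegrable la (Q \o q) -> (forall x, normc (q x) <= s1) ->
    `|\int[la]_x g (q x) - complex.Re (cintegral la (Q \o q))| <= e / 8.
  move=> hC cq cgq iQ qs.
  have cgc : continuous (fun x => (g (q x))%:C%C).
    by apply/continuous_ReIm; split => //= x; exact: cvg_cst.
  have ig := continuous_cintegrable la hC cgc.
  have iN := cintegrableZ (-1) iQ.
  have eqI : (\int[la]_x g (q x) - complex.Re (cintegral la (Q \o q)))%R =
      complex.Re (cintegral la (fun x => (g (q x))%:C%C + (-1) * Q (q x))).
    by rewrite (cintegralD ig iN) ReD (cintegralZ (-1) iQ) mulN1r ReN.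
  rewrite eqI (le_trans (ler_Re_normc _))//.
  have [i1 i2] := cintegrableD ig iN.
  have m1 := measurable_int _ i1; have m2 := measurable_int _ i2.
  apply: normc_cintegral_le; [by split; exact/measurable_EFinP|exact: ltW|].
  by move=> x; rewrite mulN1r; apply: gQ; rewrite (le_trans (qs x))// lerDl.
have iQp : cintegrable mu (Q \o p).
  have -> : Q \o p = eval_expr (fun chi : dual_group R A => chi : A -> R[i]) s.
    by apply/funext => x; exact: (sE _ (fun chi : dual_group R A => chi : A -> R[i])).
  apply: cintegrable_sum => t; apply: cintegrableZ.
  exact: (cintegrable_word mu hA (fun chi : dual_group R A => chi)).
have iQp' : cintegrable nu (Q \o p').
  have -> : Q \o p' = eval_expr (fun chi : dual_group R A => psi chi : B -> R[i]) s.
    by apply/funext => x; exact: sE.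
  by apply: cintegrable_sum => t; apply: cintegrableZ; exact: cintegrable_word.
have E3 := intQ _ mu p hA cp cgp iQp bound_p.
have E4 := intQ _ nu p' hB cp' cgp' iQp' bound_p'.
rewrite QE in E4.
have b1 : K * nn mu (fun x => f x - p x) <= e / 8.
  by apply: le_trans Kdl; rewrite ler_wpM2l.
have b2 : K * nn nu (fun x => h x - p' x) <= e / 8.
  by apply: le_trans Kdl; rewrite ler_wpM2l.
have b3 : c * nn mu f <= e / 8.
  by apply: le_trans cB; rewrite ler_wpM2l// lerDl.
have nh1 : nn nu h <= B0 by apply: (le_trans nnh); rewrite lerD2l.
have b4 : c * nn nu h <= e / 8 by apply: le_trans cB; exact: ler_wpM2l.
exact: (four_step_distance E1 E2 E3 E4 b1 b2 b3 b4).
Qed.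

End tight.

Theorem theorem3p4 (R : realType)
  (A_ : nat -> topologicalZmodType) (A : topologicalZmodType)
  (mu_ : forall i, probability (borel (A_ i)) R) (mu : probability (borel A) R)
  (f_ : forall i, {mfun borel (A_ i) >-> borel R[i]})
  (f : {mfun borel A >-> borel R[i]})
  (hA_ : forall i, compact_abelian_group (A_ i)) (hA : compact_abelian_group A)
  (hmu_ : forall i, haar (mu_ i)) (hmu : haar mu)
  (hf_ : exists M : R, forall i, {ae mu_ i, forall x, normc (f_ i x) <= M})
  (hf : (L2norm mu f < +oo)%E)
  (hlim : d_tight (mu_ i) mu (f_ i) f @[i --> \oo] --> 0%E) :
  weak_cvg (fun i => distribution (mu_ i) (f_ i)) (distribution mu f).
Proof.
move=> g cg [M gM].
(* Change of variables: the laws live on the same plane, but the estimate is made on the groups. *)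
have intE (C : topologicalZmodType) (la : probability (borel C) R)
    (h : {mfun borel C >-> borel R[i]}) :
    \int[distribution la h]_x g x = \int[la]_x g (h x).
  have mg := continuous_borel_measurable cg.
  rewrite /Rintegral (integral_distribution (f := fun x : borel R[i] => (g x)%:E))//.
    exact/measurable_EFinP.
  apply: (@bounded_integrable _ _ _ la (g \o h) M).
    exact: (measurableT_comp mg (measurable_funPT h)).
  by move=> x; exact: gM.
apply/cvgrPdist_le => e e_gt0.
have [e0 e00 H] := tight_close hA hmu (measurable_funPT f) hf cg gM e_gt0.
have nb : nbhs (0%E : \bar R) [set x | (x < e0%:E)%E].
  apply: open_nbhs_nbhs; split; first exact: open_ereal_lt_ereal.
  by rewrite /= lte_fin.
have [n _ hn] : \forall i \near \oo, (d_tight (mu_ i) mu (f_ i) f < e0%:E)%E.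
  exact: hlim _ nb.
exists n => // i /= /hn di; rewrite !intE distrC.
exact: H (hA_ i) (hmu_ i) (measurable_funPT (f_ i)) di.
Qed.
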